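(* Let $\lambda>1$ be fixed and let $G_n\in\mathrm{ER}(n,\lambda/n)$ be the Erdős–Rényi random graph with giant component $\mathscr{C}_{\max}$. Then $\mathbb{E}(\delta_{fp}(\mathscr{C}_{\max}))=o(\log n)$ with high probability; that is, for every $\varepsilon>0$, $\mathbb{P}\big(\mathbb{E}(\delta_{fp}(\mathscr{C}_{\max}))\le\varepsilon\log n\big)\to1$ as $n\to\infty$, the probability being over $G_n$.
   Context: $\mathrm{ER}(n,p)$ is the random graph on $n$ labelled vertices in which each pair of vertices is joined by an edge independently with probability $p$. The giant component $\mathscr{C}_{\max}$ is the largest connected component. For a finite connected graph $G$ with shortest-path metric $d$ and vertices $x,y,z,w$, let $P=d(x,y)+d(z,w)$, $Q=d(x,z)+d(y,w)$, $R=d(x,w)+d(y,z)$ and $\mathrm{fp}(x,y,z,w)=\tfrac12[\max(P,Q,R)-\mathrm{med}(P,Q,R)]$. The average hyperbolicity $\mathbb{E}(\delta_{fp}(G))$ is the expectation of $\mathrm{fp}(x,y,z,w)$ for $x,y,z,w$ i.i.d. uniform vertices of $G$; for random $G$ it is a random variable depending on $G$. *)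

(* Defs.v *)
From mathcomp Require Import all_boot all_order all_algebra.
From mathcomp Require Import reals.

Set Implicit Arguments.
Unset Strict Implicit.
Unset Printing Implicit Defensive.

Import Order.TTheory GRing.Theory Num.Theory.

Local Open Scope ring_scope.

Section FiniteGraphs.
Variables (T : finType) (e : rel T).

(* When y is not reachable from x this is the junk value #|T|; a shortest path
   always has fewer than #|T| edges. *)
Definition gdist (x y : T) : nat :=
  \big[minn/#|T|]_(k < #|T| | [exists p : k.-tuple T, path e x p && (last x p == y)]) k.

Definition max3 (a b c : nat) : nat := maxn (maxn a b) c.

Definition med3 (a b c : nat) : nat := nth 0%N (sort leq [:: a; b; c]) 1.

Definition fp (R : realType) (x y z w : T) : R :=
  let P := (gdist x y + gdist z w)%N in
  let Q := (gdist x z + gdist y w)%N in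
  let S := (gdist x w + gdist y z)%N in
  ((max3 P Q S)%:R - (med3 P Q S)%:R) / 2.

(* The expectation of fp at four independent uniform vertices. *)
Definition avg_hyp (R : realType) : R :=
  (\sum_(x : T) \sum_(y : T) \sum_(z : T) \sum_(w : T) fp R x y z w)
    / #|T|%:R ^+ 4.

Definition components : {set {set T}} :=
  [set [set y | connect e x y] | x : T].

Definition is_largest_component (C : {set T}) : bool :=
  (C \in components) && [forall C' in components, (#|C'| <= #|C|)%N].

Definition induced_rel (C : {set T}) : rel {x : T | x \in C} :=
  fun u v => e (val u) (val v).

End FiniteGraphs.

Arguments induced_rel [T] e C _ _.

Definition vpair (n : nat) := {s : {set 'I_n} | #|s| == 2%N}.

(* A simple graph on n labelled vertices, given by its set of edges. *)
Definition graph (n : nat) := {set vpair n}.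

Definition adj (n : nat) (G : graph n) : rel 'I_n :=
  fun u v => [exists s in G, val s == [set u; v]].

(* The probability of the event A under ER(n, p). This is a probability for
   0 <= p <= 1; for p = lambda / n that excludes only finitely many n. *)
Definition er_prob (R : realType) (n : nat) (p : R) (A : pred (graph n)) : R :=
  \sum_(G : graph n | A G) \prod_(s : vpair n) (if s \in G then p else 1 - p).

(* Main.v *)
(* For every m, fp(x,y,z,w) is at most half the sum of |d - m| over the six pairs
   of {x,y,z,w}. It therefore suffices that all but a negligible fraction of the
   pairs of C_max are at distance (1 + o(1)) log n / log lambda and that the
   diameter of C_max is O(log n).

   Explore the graph from a set of sources by breadth-first search, S_j being the
   vertices at distance < j and A_j those at distance j. The mean of |A_j| is at
   most lambda^j for a single source, so few pairs are too close. For
   1 < rho < lambda and small theta, exp(- theta |A_j| + theta (rho - 1 + theta) |S_j|),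
   killed when |S_j| > theta n, is a supermartingale; hence once |S_j| >= m the
   explored set grows by a factor rho at each step, up to linear size, except with
   probability exp(- theta^2 m) per step. If x and y both have vertices at distance r,
   then x has a layer of linear size at some distance at most r + log_rho n, y has one
   of size at least a constant times r at some distance at most r, and if the two
   explorations have not met, the edges between these layers are unexposed and all
   absent with probability exp(- c r). With r = eps log n this bounds typical
   distances, with r a large multiple of log n it bounds the diameter. Finally the
   exploration from about log n sources reaches theta n vertices with probability at
   least 1 - n^(- theta), so |C_max| is at least of order n / log n, which is enough
   because the bad pairs are polynomially rare. *)

Require Import Defs.
From mathcomp Require Import all_boot all_order all_algebra.
From mathcomp Require Import all_classical all_reals all_analysis.
(* [fintype] and [finset] come last so that their lemma names take precedence
   over the homonyms of [classical_sets]. *)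
From mathcomp Require Import ring lra zify fintype finset.

Import Order.TTheory GRing.Theory Num.Theory.
Import numFieldNormedType.Exports.

Set Implicit Arguments.
Unset Strict Implicit.
Unset Printing Implicit Defensive.

Local Open Scope ring_scope.

(** * Random edge sets *)

Section RandomSubset.
Variables (R : realType) (E : finType) (p : R).

Definition Ex (F : {set E} -> R) : R :=
  \sum_(G : {set E}) (\prod_(s : E) (if s \in G then p else 1 - p)) * F G.

Lemma Ex_const (c : R) : Ex (fun=> c) = c.
Proof.
rewrite /Ex -big_distrl /=.
have <- : \prod_(s : E) (p + (1 - p)) = \sum_(G : {set E}) \prod_s (if s \in G then p else 1 - p).
  by rewrite bigA_distr; apply: eq_bigl => G; rewrite inE.
by rewrite big1 ?mul1r // => s _; rewrite addrC subrK.
Qed.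

Lemma eq_Ex F1 F2 : F1 =1 F2 -> Ex F1 = Ex F2.
Proof. by move=> eqF; apply: eq_bigr => G _; rewrite eqF. Qed.

Lemma ExZ (c : R) F : Ex (fun G => c * F G) = c * Ex F.
Proof. by rewrite /Ex big_distrr /=; apply: eq_bigr => G _; rewrite mulrCA. Qed.

Lemma ExD F1 F2 : Ex (fun G => F1 G + F2 G) = Ex F1 + Ex F2.
Proof. by rewrite /Ex -big_split /=; apply: eq_bigr => G _; rewrite mulrDr. Qed.

Lemma Ex_sum (I : Type) (r : seq I) (P : pred I) (F : I -> {set E} -> R) :
  Ex (fun G => \sum_(i <- r | P i) F i G) = \sum_(i <- r | P i) Ex (F i).
Proof.
by rewrite /Ex exchange_big /=; apply: eq_bigr => G _; rewrite big_distrr.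
Qed.

(** Independence of [F] from the edge [s] is expressed as invariance under deleting [s]. Pairing
    each [G] without [s] with [s |: G] then factors out the weight of [s]. *)
Lemma Ex_edge_absent (s : E) F : (forall G, F (G :\ s) = F G) ->
  Ex (fun G => F G * (s \notin G)%:R) = (1 - p) * Ex F.
Proof.
move=> Fs; pose w (G : {set E}) := \prod_(t | t != s) (if t \in G then p else 1 - p).
have split_s H : Ex H = \sum_(G : {set E} | s \notin G)
    w G * ((1 - p) * H G + p * H (s |: G)).
  pose g (G : {set E}) := (\prod_(t : E) (if t \in G then p else 1 - p)) * H G.
  have -> : Ex H = \sum_(G : {set E} | s \notin G) g G + \sum_(G : {set E} | s \in G) g G.
    rewrite /Ex (bigID (fun G : {set E} => s \notin G)) /=; congr (_ + _).
    by apply: eq_bigl => G; rewrite negbK.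
  have -> : \sum_(G : {set E} | s \in G) g G = \sum_(G : {set E} | s \notin G) g (s |: G).
    rewrite (reindex_onto (fun G : {set E} => s |: G) (fun G : {set E} => G :\ s)) /=.
      apply: eq_bigl => G; rewrite in_setU1 eqxx /=.
      apply/eqP/idP => [<-|sG]; first by rewrite !inE eqxx.
      by rewrite setU1K.
    by move=> G sG; rewrite setD1K.
  rewrite -big_split; apply: eq_bigr => G sG /=.
  rewrite /g (bigD1 s) //= [X in _ + X * _](bigD1 s) //= (negPf sG) in_setU1 eqxx /=.
  have -> : \prod_(i | i != s) (if i \in s |: G then p else 1 - p) = w G.
    by apply: eq_bigr => i /negPf is'; rewrite in_setU1 is'.
  by rewrite -/(w G); ring.
rewrite !split_s big_distrr /=; apply: eq_bigr => G sG.
rewrite in_setU1 eqxx sG /= mulr0 mulr1 mulr0 addr0.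
have -> : F (s |: G) = F G by rewrite -(Fs (s |: G)) setU1K.
ring.
Qed.

Lemma Ex_disjoint (D : {set E}) F : (forall G, F (G :\: D) = F G) ->
  Ex (fun G => F G * [disjoint G & D]%:R) = (1 - p) ^+ #|D| * Ex F.
Proof.
have [m] := ubnP #|D|; elim: m D F => // m IHm D F leDm FD.
have [->|/set0Pn[s sD]] := eqVneq D set0.
  by rewrite cards0 expr0 mul1r; apply: eq_Ex => G; rewrite disjoints_subset setC0 subsetT mulr1.
have cD : #|D| = #|D :\ s|.+1 by rewrite (cardsD1 s) sD.
have dE (G : {set E}) : [disjoint G & D] = (s \notin G) && [disjoint G & D :\ s].
  rewrite !disjoints_subset; apply/subsetP/andP => [sub|[sG /subsetP sub] x xG].
    split; first by apply: contraL sD => /sub; rewrite inE.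
    by apply/subsetP => x /sub; rewrite !inE negb_and => ->; rewrite orbT.
  by move: (sub x xG); rewrite !inE; case: eqVneq xG sG => //= -> ->.
have FDs G : F (G :\: (D :\ s)) = F G.
  by rewrite -(FD (G :\: (D :\ s))) -(FD G); congr F; apply/setP => x; rewrite !inE; case: (x \in D); rewrite ?andbF.
have Fs G : F (G :\ s) = F G.
  rewrite -(FD (G :\ s)) -(FD G); congr F; apply/setP => x; rewrite !inE.
  by case: eqVneq => // ->; rewrite sD.
rewrite cD exprS -mulrA -(IHm (D :\ s)) //; last by rewrite -ltnS -cD.
rewrite -(@Ex_edge_absent s).
  by apply: eq_Ex => G; rewrite dE andbC -mulnb natrM mulrA.
move=> G; rewrite Fs; congr (F G * _%:R); congr (nat_of_bool _).
by rewrite !disjoints_subset; apply/subsetP/subsetP => sub x; move: (sub x);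
  rewrite !inE; case: eqVneq => //=.
Qed.

(** Replaces conditional expectations: both sides split over the fibres of [X], on each of which the
    value of [X] is a constant. *)
Lemma Ex_cond (V : finType) (X : {set E} -> V) (f g : V -> {set E} -> R) :
  (forall v, Ex (fun G => (X G == v)%:R * f v G) <= Ex (fun G => (X G == v)%:R * g v G)) ->
  Ex (fun G => f (X G) G) <= Ex (fun G => g (X G) G).
Proof.
have splitX h : Ex (fun G => h (X G) G) = \sum_v Ex (fun G => (X G == v)%:R * h v G).
  rewrite -Ex_sum; apply: eq_Ex => G.
  rewrite (bigD1 (X G)) //= eqxx mul1r big1 ?addr0 // => v /negPf.
  by rewrite eq_sym => ->; rewrite mul0r.
by move=> le_fg; rewrite !splitX; apply: ler_sum.
Qed.

Section Positive.
Hypothesis p01 : 0 <= p <= 1.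

Lemma Ex_le F1 F2 : (forall G, F1 G <= F2 G) -> Ex F1 <= Ex F2.
Proof.
move=> leF; apply: ler_sum => G _; apply: ler_wpM2l => //.
apply: prodr_ge0 => s _; case: ifP => _; first by case/andP: p01.
by rewrite subr_ge0; case/andP: p01.
Qed.

Lemma Ex_ge0 F : (forall G, 0 <= F G) -> 0 <= Ex F.
Proof. by move=> F0; rewrite -(Ex_const 0) Ex_le. Qed.

Lemma Ex_markov (P : pred {set E}) F (c : R) : 0 < c ->
  (forall G, 0 <= F G) -> (forall G, P G -> c <= F G) ->
  Ex (fun G => (P G)%:R) <= Ex F / c.
Proof.
move=> c0 F0 cF; rewrite ler_pdivlMr // mulrC -ExZ; apply: Ex_le => G.
by case: (boolP (P G)) => [/cF|_]; rewrite ?mulr1 ?mulr0.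
Qed.

End Positive.

End RandomSubset.

(** * Breadth-first exploration *)

Section Exploration.
Local Open Scope nat_scope.
Variable T : finType.
Implicit Types (e : rel T) (A S : {set T}).

Definition nbh e A : {set T} := [set v | [exists u in A, e u v]].

(* [bfs e A j] is the pair of the set of vertices at distance < j from [A] and the
   set of those at distance exactly j. *)
Fixpoint bfs e A (j : nat) : {set T} * {set T} :=
  if j is i.+1 then
    let s := bfs e A i in (s.1 :|: s.2, nbh e s.2 :\: (s.1 :|: s.2))
  else (set0, A).

Definition reach e (k : nat) (x y : T) : Prop :=
  exists p, [/\ path e x p, last x p = y & size p <= k].

Lemma bfsS1 e A j : (bfs e A j.+1).1 = (bfs e A j).1 :|: (bfs e A j).2.
Proof. by []. Qed.

Lemma bfs_disjoint e A j : [disjoint (bfs e A j).1 & (bfs e A j).2].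
Proof.
case: j => [|j] /=; first by rewrite disjoints_subset sub0set.
by rewrite disjoints_subset; apply/subsetP => x; rewrite !inE negb_and => ->.
Qed.

Lemma card_bfsS1 e A j : #|(bfs e A j.+1).1| = #|(bfs e A j).1| + #|(bfs e A j).2|.
Proof.
rewrite bfsS1 cardsU; have := bfs_disjoint e A j.
by rewrite -setI_eq0 => /eqP ->; rewrite cards0 subn0.
Qed.

Lemma bfs1_mono e A i j : i <= j -> (bfs e A i).1 \subset (bfs e A j).1.
Proof.
elim: j => [|j IHj]; first by rewrite leqn0 => /eqP ->.
rewrite leq_eqVlt => /predU1P[-> //|/IHj sub].
by rewrite bfsS1 (fintype.subset_trans sub) // subsetUl.
Qed.

(* Only the edges that meet the first component have been exposed. *)
Lemma eq_bfs e e' A j :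
  (forall u v, u \in (bfs e A j).1 -> e u v = e' u v) -> bfs e' A j = bfs e A j.
Proof.
elim: j => // j IHj ee.
have IH : bfs e' A j = bfs e A j.
  by apply: IHj => u v uS; apply: ee; rewrite bfsS1 inE uS.
rewrite /= IH; congr (_, _ :\: _); apply/setP => v; rewrite !inE.
apply: eq_existsb => u; case: (boolP (u \in _)) => //= uA.
by rewrite -ee // bfsS1 inE uA orbT.
Qed.

Lemma bfs_level_nonempty e A i j :
  i <= j -> (bfs e A j).2 != set0 -> (bfs e A i).2 != set0.
Proof.
elim: j => [|j IHj]; first by rewrite leqn0 => /eqP ->.
rewrite leq_eqVlt => /predU1P[-> //|leij] /set0Pn[v /=].
rewrite !inE => /andP[_ /existsP[u /andP[uA _]]].
by apply: IHj => //; apply/set0Pn; exists u.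
Qed.

(** Levels [0] to [j] are disjoint and nonempty, so each contributes a vertex. *)
Lemma bfs_alive_size e A j : (bfs e A j).2 != set0 -> j < #|(bfs e A j.+1).1|.
Proof.
elim: j => [|j IHj] alive.
  by rewrite card_bfsS1 cards0 card_gt0.
have /IHj lt : (bfs e A j).2 != set0 by apply: bfs_level_nonempty alive.
by rewrite card_bfsS1 -addn1 leq_add // card_gt0.
Qed.

Lemma nbh_bfs e A j u v : u \in (bfs e A j).1 -> e u v -> v \in (bfs e A j.+1).1.
Proof.
elim: j => [|j IHj]; first by rewrite inE.
rewrite bfsS1 inE => /orP[uS|uA] euv; first by rewrite bfsS1 inE IHj.
have vN : v \in nbh e (bfs e A j).2 by rewrite inE; apply/existsP; exists u; rewrite uA.
by rewrite bfsS1 inE /= -implyNb; apply/implyP => vS; rewrite inE vS.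
Qed.

(** The index is [k.+1] because the first component collects the distances strictly below its
    index. *)
Lemma bfs1_reach e A k y :
  y \in (bfs e A k.+1).1 <-> exists2 x, x \in A & reach e k x y.
Proof.
split=> [|[x xA [p [ep <-]]]]; last first.
  elim/last_ind: p k ep => [k _ _|p z IHp [|k]].
  - have : x \in (bfs e A 1).1 by rewrite /= inE xA orbT.
    by apply/fintype.subsetP/bfs1_mono.
  - by rewrite size_rcons.
  rewrite rcons_path last_rcons size_rcons ltnS => /andP[ep ez] /(IHp _ ep) pS.
  exact: nbh_bfs ez.
elim: k y => [|k IHk] y.
  by rewrite /= set0U => yA; exists y => //; exists [::].
rewrite bfsS1 inE => /orP[/IHk[x xA [p [ep lp sp]]]|].
  by exists x => //; exists p; split=> //; apply: leqW.
rewrite /= inE => /andP[_]; rewrite inE => /existsP[u /andP[uA euy]].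
have /IHk[x xA [p [ep lp sp]]] : u \in (bfs e A k.+1).1 by rewrite bfsS1 inE uA orbT.
exists x => //; exists (rcons p y).
by rewrite rcons_path ep lp euy last_rcons size_rcons.
Qed.

Lemma bfs2_reach e A k y : y \in (bfs e A k).2 -> exists2 x, x \in A & reach e k x y.
Proof. by move=> yA; apply/bfs1_reach; rewrite bfsS1 inE yA orbT. Qed.

Lemma reach_mono e k l x y : k <= l -> reach e k x y -> reach e l x y.
Proof. by move=> kl [p [ep lp sp]]; exists p; split=> //; apply: leq_trans kl. Qed.

Lemma reach_trans e k l x y z :
  reach e k x y -> reach e l y z -> reach e (k + l) x z.
Proof.
move=> [p [ep lp sp]] [q [eq lq sq]]; exists (p ++ q).
by rewrite cat_path ep lp eq last_cat lp lq size_cat leq_add.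
Qed.

Lemma reach_sym e k x y : symmetric e -> reach e k x y -> reach e k y x.
Proof.
move=> e_sym [p [ep <- sp]]; exists (rev (belast x p)).
rewrite size_rev size_belast sp; split=> //.
  by rewrite rev_path (eq_path (e' := e)).
by case: p {ep sp} => //= z p; rewrite rev_cons last_rcons.
Qed.

Lemma connect_reach e x y : connect e x y <-> exists k, reach e k x y.
Proof.
split=> [/connectP[p ep ->]|[k [p [ep <- _]]]]; first by exists (size p), p.
by apply/connectP; exists p.
Qed.

Lemma alive_of_not_reach e k r x y : connect e x y -> ~ reach e k x y -> r <= k ->
  (bfs e [set x] r).2 != set0.
Proof.
move=> cxy nxy lerk; apply/eqP => dead.
case: r lerk dead => [_ /setP/(_ x)|r lerk dead]; first by rewrite !inE eqxx.
have xS : x \in (bfs e [set x] r.+1).1.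
  by apply/bfs1_reach; exists x; [rewrite inE | exists [::]].
(* With level [r.+1] empty, the ball of radius [r] is closed under [e]. It then contains all that is
   reachable from [x], so [y] would lie within distance [r < k]. *)
have cl u v : u \in (bfs e [set x] r.+1).1 -> e u v -> v \in (bfs e [set x] r.+1).1.
  by move=> uS /(nbh_bfs uS); rewrite (bfsS1 _ _ r.+1) in_setU dead in_set0 orbF.
have : y \in (bfs e [set x] r.+1).1.
  case/connectP: cxy => p ep ->; move: (_.1) xS cl ep => B.
  elim: p x {nxy dead} => //= z p IHp x xS cl /andP[exz ep].
  exact: IHp (cl _ _ xS exz) cl ep.
move=> /bfs1_reach[x']; rewrite inE => /eqP -> w.
by apply: nxy; apply: reach_mono w; apply: ltnW.
Qed.

(** A common vertex of the two balls, or an edge between their last levels, would give a walk of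
    length at most [i + j + 1]. *)
Lemma meeting e i j x y : symmetric e -> ~ reach e (i + j).+1 x y ->
  [disjoint (bfs e [set x] j.+1).1 & (bfs e [set y] i.+1).1] /\
  (forall u v, u \in (bfs e [set x] j).2 -> v \in (bfs e [set y] i).2 -> ~~ e u v).
Proof.
move=> e_sym nxy; split=> [|u v uA vA].
  rewrite -setI_eq0; apply/eqP/setP => z; rewrite inE in_set0; apply/negP => /andP[].
  move=> /bfs1_reach[_ /set1P -> wx] /bfs1_reach[_ /set1P -> wy].
  apply: nxy; apply: reach_mono (reach_trans wx (reach_sym e_sym wy)).
  by rewrite addnC.
apply/negP => euv; apply: nxy.
have [_ /set1P -> wx] := bfs2_reach uA; have [_ /set1P -> wy] := bfs2_reach vA.
have wuv : reach e 1 u v by exists [:: v] => /=; rewrite euv.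
have := reach_trans (reach_trans wx wuv) (reach_sym e_sym wy).
by apply: reach_mono; rewrite addn1 addSn addnC.
Qed.

Lemma bfs_exhausted e A : (bfs e A #|T|).2 = set0.
Proof.
apply/eqP; apply: contraT => /bfs_alive_size.
by rewrite ltnNge max_card.
Qed.

(** The explored set is covered by the components of its sources. This turns a large exploration
    from few sources into a lower bound on the largest component. *)
Lemma card_bfs_le_component e A C j : is_largest_component e C ->
  #|(bfs e A j).1| <= #|A| * #|C|.
Proof.
move=> /andP[_ /forall_inP maxC].
have sub : (bfs e A j).1 \subset \bigcup_(x in A) [set y | connect e x y].
  apply/subsetP => y; case: j => [|j]; first by rewrite inE.
  move=> /bfs1_reach[x xA wxy]; apply/bigcupP; exists x => //; rewrite inE.
  by apply/connect_reach; exists j.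
apply: leq_trans (subset_leq_card sub) _.
apply: (@leq_trans (\sum_(x in A) #|[set y | connect e x y]|)).
  apply: (big_ind2 (fun (B : {set T}) m => #|B| <= m)) => // [|B1 m1 B2 m2 le1 le2].
    by rewrite cards0.
  by apply: leq_trans (leq_card_setU B1 B2) (leq_add le1 le2).
rewrite -sum_nat_const; apply: leq_sum => x _.
by apply: maxC; apply/imsetP; exists x.
Qed.

Lemma bigminn_le (I : eqType) (r : seq I) (P : pred I) (F : I -> nat) m i :
  i \in r -> P i -> \big[minn/m]_(j <- r | P j) F j <= F i.
Proof.
elim: r => // k r IHr; rewrite inE big_cons => /predU1P[<- ->|ir Pi].
  exact: geq_minl.
by case: ifP => _; [apply: leq_trans (geq_minr _ _) _|]; apply: IHr.
Qed.

Lemma gdist_le e x y p : path e x p -> last x p = y -> gdist e x y <= size p.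
Proof.
move=> ep lp; rewrite /gdist.
(* Walks with at least [#|T|] edges fall outside the index range; for them the default value [#|T|]
   of the minimum suffices. *)
have [lt|ge] := ltnP (size p) #|T|; last first.
  by apply: leq_trans ge; elim/big_ind: _ => // [a b la _|i _]; [rewrite geq_min la | exact: ltnW].
apply: (bigminn_le (fun k : 'I_#|T| => k : nat) _ (mem_index_enum (Ordinal lt))).
by apply/existsP; exists (in_tuple p); rewrite ep lp eqxx.
Qed.

Lemma gdist_attained e x y : connect e x y ->
  exists p, [/\ path e x p, last x p = y & size p = gdist e x y].
Proof.
(* A duplicate-free path has fewer than [#|T|] edges, so the minimum is not the default value. *)
move=> /connectP[p ep ->]; case/shortenP: ep => p' ep' up' _.
have lt : size p' < #|T| by have := max_card [in x :: p']; rewrite (card_uniqP up').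
have := gdist_le ep' erefl; rewrite /gdist; elim/big_ind: _.
- by rewrite leqNgt lt.
- by move=> a b Ha Hb; rewrite /minn; case: ifP.
move=> i /existsP[q /andP[eq /eqP lq]] _; exists q; rewrite size_tuple; split=> //.
Qed.

End Exploration.

(** * Edges between two vertex sets *)

Section CutEdges.
Variable n : nat.
Implicit Types (G : graph n) (A W U : {set 'I_n}).

Definition edge_cut A W : {set vpair n} :=
  [set s | [exists a in A, exists w in W, val s == [set a; w]]].

Lemma adj_sym G : symmetric (adj G).
Proof. by move=> u v; apply: eq_existsb => s; rewrite setUC. Qed.

Lemma set2_eq (T : finType) (a b c d : T) :
  [set a; b] = [set c; d] -> a = c /\ b = d \/ a = d /\ b = c.
Proof.
move=> /setP eq.
move: (eq a) (eq b) (eq c) (eq d); rewrite !inE !eqxx ?orbT /=.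
move=> /esym/orP[]/eqP ea /esym/orP[]/eqP eb /orP[]/eqP ec /orP[]/eqP ed; subst; auto.
Qed.

Lemma edge_cutP s A W : reflect (exists a w, [/\ a \in A, w \in W & val s = [set a; w]])
  (s \in edge_cut A W).
Proof.
rewrite inE; apply: (iffP existsP) => [[a /andP[aA /existsP[w /andP[wW /eqP es]]]]|].
  by exists a, w.
move=> [a [w [aA wW es]]]; exists a; rewrite aA; apply/existsP; exists w.
by rewrite wW es eqxx.
Qed.

Lemma card_edge_cut A W : [disjoint A & W] -> #|edge_cut A W| = (#|A| * #|W|)%N.
Proof.
move=> dAW.
have neq a w : a \in A -> w \in W -> a != w.
  by move=> aA wW; apply: contraTneq wW => <-; rewrite (disjointFr dAW).
rewrite -(card_imset _ val_inj) -cardsX.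
have -> : [set val s | s in edge_cut A W] = [set [set x.1; x.2] | x in setX A W].
  apply/setP => B; apply/imsetP/imsetP => [[s /edge_cutP[a [w [aA wW es]]] ->]|[[a w]]].
    by exists (a, w); rewrite ?inE ?aA.
  rewrite inE /= => /andP[aA wW] ->.
  have c2 : #|[set a; w]| == 2 by rewrite cards2 neq.
  by exists (exist (fun B : {set 'I_n} => #|B| == 2%N) _ c2) => //; apply/edge_cutP; exists a, w.
rewrite card_in_imset // => -[a w] [b v]; rewrite !inE /= => /andP[aA wW] /andP[bA vW].
move=> /set2_eq[[-> ->] //|[ea _]].
by case/eqP: (neq _ _ aA vW).
Qed.

Lemma adj_edge_cut G A W u v : adj (G :\: edge_cut A W) u v =
  adj G u v && ~~ ((u \in A) && (v \in W) || (u \in W) && (v \in A)).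
Proof.
apply/existsP/andP => [[s /andP[]]|[/existsP[s /andP[sG /eqP es]] nAW]].
  rewrite inE => /andP[sN sG] /eqP es; split.
    by apply/existsP; exists s; rewrite sG es eqxx.
  apply: contra sN => /orP[]/andP[uX vX]; apply/edge_cutP; first by exists u, v.
  by exists v, u; rewrite setUC.
exists s; rewrite inE sG es eqxx andbT andbT.
apply: contra nAW => /edge_cutP[a [w [aA wW]]]; rewrite es => /set2_eq[] [-> ->].
  by rewrite aA wW.
by rewrite wW aA orbT.
Qed.

Lemma disjoint_edge_cut G A W : [disjoint G & edge_cut A W] =
  [forall a in A, forall w in W, ~~ adj G a w].
Proof.
rewrite disjoints_subset; apply/subsetP/forall_inP => [sub a aA|no s sG].
  apply/forall_inP => w wW; apply/negP => /existsP[s /andP[sG /eqP es]].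
  by have := sub s sG; rewrite inE => /edge_cutP[]; exists a, w.
rewrite inE; apply/negP => /edge_cutP[a [w [aA wW es]]].
have /forall_inP/(_ w wW)/negP := no a aA.
by apply; apply/existsP; exists s; rewrite sG es eqxx.
Qed.

Lemma disjoint_edge_cut1 G A v : [disjoint G & edge_cut A [set v]] = (v \notin nbh (adj G) A).
Proof.
rewrite disjoint_edge_cut inE negb_exists; apply: eq_forallb => a; rewrite negb_and implybE.
congr (_ || _); apply/forall_inP/idP => [/(_ v)|nav w]; first by rewrite inE eqxx => /(_ isT).
by rewrite inE => /eqP ->.
Qed.

Variables (R : realType) (p : R).

(** Given the exposed information [f], each vertex of [U] misses the neighbourhood of [A]
    independently with probability [(1 - p) ^+ #|A|]. The number of vertices hit is thus binomial,
    and the factor is its generating function at [t]. *)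
Lemma Ex_nbh_power (t : R) A U (f : graph n -> R) : [disjoint A & U] ->
  (forall v G, v \in U -> f (G :\: edge_cut A [set v]) = f G) ->
  Ex p (fun G => f G * t ^+ #|nbh (adj G) A :&: U|) =
  (t + (1 - t) * (1 - p) ^+ #|A|) ^+ #|U| * Ex p f.
Proof.
have [m] := ubnP #|U|; elim: m U => // m IHm U leUm dAU fU.
have [->|/set0Pn[v vU]] := eqVneq U set0.
  by rewrite cards0 expr0 mul1r; apply: eq_Ex => G; rewrite setI0 cards0 expr0 mulr1.
set z := t + _; have cU : #|U| = #|U :\ v|.+1 by rewrite (cardsD1 v) vU.
have vA : v \notin A by rewrite (disjointFl dAU).
rewrite cU exprS -mulrA -IHm; last 3 first.
- by rewrite -ltnS -cU.
- by apply: disjointWr dAU; apply: subD1set.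
- by move=> w G; rewrite inE => /andP[_]; apply: fU.
set g := fun G : graph n => f G * t ^+ #|nbh (adj G) A :&: (U :\ v)|.
have gv G : g (G :\: edge_cut A [set v]) = g G.
  rewrite /g fU //; congr (_ * _ ^+ _); apply: eq_card => w; rewrite !inE.
  case: (eqVneq w v) => [->|wv]; first by rewrite !andbF.
  congr (_ && _); apply: eq_existsb => a; case: (boolP (a \in A)) => //= aA.
  rewrite adj_edge_cut !inE (negPf wv) andbF /= (_ : a == v = false) ?andbT //.
  by apply: contraNF vA => /eqP <-.
have dAv : [disjoint A & [set v]] by apply: disjointWr dAU; rewrite sub1set.
(* One vertex is peeled off by writing t^[v hit] = t + (1 - t) [v not hit], where v is not hit
   exactly when the cut from [A] to [v] is absent. *)
transitivity (Ex p (fun G => t * g G + (1 - t) * (g G * [disjoint G & edge_cut A [set v]]%:R))).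
  apply: eq_Ex => G; rewrite disjoint_edge_cut1.
  have -> : #|nbh (adj G) A :&: U| = ((v \in nbh (adj G) A) + #|nbh (adj G) A :&: (U :\ v)|)%N.
    rewrite (cardsD1 v) inE vU andbT; congr (_ + _)%N; apply: eq_card => w; rewrite !inE.
    by rewrite andbCA.
  rewrite -/(g G) exprD mulrCA -/(g G).
  by move: (g G) => c; case: (v \in _) => /=; rewrite ?expr0 ?expr1; ring.
rewrite ExD !ExZ Ex_disjoint // card_edge_cut // cards1 muln1 /z.
by move: (Ex p g) (_ ^+ _) => c d; ring.
Qed.

(** By linearity: each vertex of [U] is hit with probability 1 - (1 - p)^|A|, at most p|A| by
    Bernoulli's inequality. *)
Lemma Ex_nbh_card A U (f : graph n -> R) : 0 <= p <= 1 -> [disjoint A & U] ->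
  (forall G, 0 <= f G) ->
  (forall v G, v \in U -> f (G :\: edge_cut A [set v]) = f G) ->
  Ex p (fun G => f G * #|nbh (adj G) A :&: U|%:R) <= p * #|A|%:R * #|U|%:R * Ex p f.
Proof.
move=> p01 dAU f0 fU.
have -> : Ex p (fun G => f G * #|nbh (adj G) A :&: U|%:R) =
    \sum_(v in U) Ex p (fun G => f G + - 1 * (f G * [disjoint G & edge_cut A [set v]]%:R)).
  rewrite -Ex_sum; apply: eq_Ex => G.
  rewrite -sum1_card natr_sum big_distrr /=.
  rewrite [RHS](bigID (fun v => v \in nbh (adj G) A)) /= [X in _ = _ + X]big1 => [|v /andP[_ vN]].
    rewrite addr0; apply: eq_big => [v|v]; first by rewrite inE andbC.
    by rewrite inE disjoint_edge_cut1 => /andP[-> _]; rewrite mulr0 mulr0 addr0 mulr1.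
  by rewrite disjoint_edge_cut1 vN mulr1 mulN1r subrr.
rewrite mulrAC [X in _ <= X]mulr_natr -sumr_const; apply: ler_sum => v vU.
rewrite ExD ExZ Ex_disjoint; last by move=> G; apply: fU.
have dAv : [disjoint A & [set v]] by apply: disjointWr dAU; rewrite sub1set.
rewrite card_edge_cut // cards1 muln1.
suff : 1 - p * #|A|%:R <= (1 - p) ^+ #|A|.
  by move=> H; have := Ex_ge0 p01 f0; nra.
elim: #|A| => [|a IHa]; first by rewrite mulr0 subr0 expr0.
rewrite exprS -natr1; have a0 : 0 <= a%:R :> R by [].
have : 0 <= (1 - p) ^+ a by apply: exprn_ge0; lra.
nra.
Qed.
End CutEdges.

(** * The exploration supermartingale *)

(** Gives the lower bound pa / (1 + pa) on the probability 1 - (1 - p)^a that a vertex is hit by a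
    level of size [a]. *)
Lemma bernoulli_power_le (R : realType) (p : R) (a : nat) : 0 <= p <= 1 ->
  (1 - p) ^+ a * (1 + p * a%:R) <= 1.
Proof.
move=> p01; elim: a => [|a IHa]; first by rewrite expr0 mulr0 addr0 mulr1.
have a0 : 0 <= a%:R :> R by [].
have c0 : 0 <= (1 - p) ^+ a by apply: exprn_ge0; lra.
rewrite exprS -natr1; apply: le_trans IHa.
rewrite -mulrA mulrCA; apply: ler_wpM2l => //.
have : 0 <= p * p * (1 + a%:R) by apply: mulr_ge0; nra.
nra.
Qed.

Section Drift.
Variables (R : realType) (n : nat) (lambda rho theta : R).
Hypotheses (n0 : (0 < n)%N) (lambdan : 0 < lambda <= n%:R).
Hypotheses (theta01 : 0 < theta < 1) (rho1 : 1 < rho)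
  (drift : (rho + theta) * (1 + lambda * theta) * (1 + theta) <= (1 - theta) * lambda).

Notation p := (lambda / n%:R).
Notation b := (theta * (rho - 1 + theta)).

Let nR0 : 0 < n%:R :> R. Proof. by rewrite ltr0n. Qed.

Lemma edge_prob01 : 0 <= p <= 1.
Proof. by case/andP: lambdan => l0 ln; rewrite ler_pdivrMr // mul1r ln andbT divr_ge0 // ltW. Qed.

(** With t = exp(-theta) and hitting probability q, the base is 1 - (1 - t)q <= exp(-(1 - t)q). Here
    1 - t >= theta / (1 + theta), q >= pa / (1 + lambda theta) and u >= (1 - theta)n; [drift] says
    exactly that the resulting exponent is at least theta (rho + theta) a, which is (theta + b)a. *)
Lemma step_factor_le (a u : nat) : a%:R <= theta * n%:R -> (1 - theta) * n%:R <= u%:R ->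
  (expR (- theta) + (1 - expR (- theta)) * (1 - p) ^+ a) ^+ u <= expR (- (theta + b) * a%:R).
Proof.
move=> lea leu; set t := expR (- theta); set q := 1 - (1 - p) ^+ a.
have [l0 _] := andP lambdan; have [th0 th1] := andP theta01.
have p01 := edge_prob01.
have pn : p * n%:R = lambda by rewrite divfK // gt_eqF.
have pa : p * a%:R <= lambda * theta.
  by case/andP: p01 => p0 _; have := ler_wpM2l p0 lea; rewrite mulrCA pn [theta * _]mulrC.
have t0 : 0 < t by apply: expR_gt0.
have tle : t * (1 + theta) <= 1.
  have : t * expR theta = 1 by rewrite -expRD addNr expR0.
  by have := expR_ge1Dx theta; nra.
have q0 : 0 <= q by rewrite subr_ge0 exprn_ile1 //; lra.
have qle : p * a%:R <= q * (1 + lambda * theta).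
  have := bernoulli_power_le a p01; have : 0 <= (1 - p) ^+ a by apply: exprn_ge0; lra.
  have := mulr_ge0 q0 (_ : 0 <= lambda * theta - p * a%:R); rewrite subr_ge0 => /(_ pa).
  rewrite /q; move: ((1 - p) ^+ a) (p * a%:R) => c x; lra.
have -> : t + (1 - t) * (1 - p) ^+ a = 1 - (1 - t) * q by rewrite /q; ring.
apply: (@le_trans _ _ (expR (- ((1 - t) * q)) ^+ u)).
  have q1 : q <= 1 by rewrite gerBl exprn_ge0 //; lra.
  rewrite lerXn2r ?nnegrE ?expR_ge0 //.
    have t1 : t <= 1 by rewrite -[leRHS]expR0 ler_expR; lra.
    by rewrite subr_ge0 mulr_ile1 //; lra.
  exact: expR_ge1Dx.
rewrite -expRM_natl ler_expR mulrN mulNr lerN2.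
have a0 : 0 <= a%:R :> R by [].
have tq : theta * (p * a%:R) <= ((1 - t) * q) * ((1 + theta) * (1 + lambda * theta)).
  have : theta <= (1 - t) * (1 + theta) by nra.
  have : 0 <= p * a%:R by apply: mulr_ge0 => //; lra.
  move: (p * a%:R) qle => x; nra.
have D0 : 0 < (1 + theta) * (1 + lambda * theta) by nra.
rewrite -(ler_pM2r D0) -[leRHS]mulrA.
apply: le_trans (_ : (1 - theta) * n%:R * (theta * (p * a%:R)) <= _).
  have -> : (1 - theta) * n%:R * (theta * (p * a%:R)) = (1 - theta) * (p * n%:R) * (theta * a%:R).
    by ring.
  rewrite pn; have : 0 <= theta * a%:R by nra.
  by move=> ta; have := ler_wpM2r ta drift; congr (_ <= _); ring.
have p0 : 0 <= p by case/andP: p01.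
by apply: ler_pM => //; rewrite ?mulr_ge0 // ?subr_ge0 ltW.
Qed.

Definition pot (s : {set 'I_n} * {set 'I_n}) : R :=
  expR (- theta * #|s.2|%:R + b * #|s.1|%:R) * (#|s.1|%:R <= theta * n%:R)%R%:R.

(** The event that the exploration is in state [(S, C)] depends only on edges meeting [S]. This is
    the invariance that [Ex_disjoint] and [Ex_nbh_power] ask for. *)
Lemma bfs_edge_cut (A S C B W : {set 'I_n}) (G : graph n) j : [disjoint S & B] -> [disjoint S & W] ->
  (bfs (adj (G :\: edge_cut B W)) A j == (S, C)) = (bfs (adj G) A j == (S, C)).
Proof.
move=> dB dW.
have ee u v : u \in S -> adj (G :\: edge_cut B W) u v = adj G u v.
  by move=> uS; rewrite adj_edge_cut (disjointFr dB uS) (disjointFr dW uS) andbT.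
apply/eqP/eqP => eS.
  by rewrite -eS; apply: eq_bfs => u v; rewrite eS => /ee.
by rewrite -eS; apply: eq_bfs => u v; rewrite eS => /ee.
Qed.

(** Supermartingale property: given the state [(S, B)], the next level is the neighbourhood of [B]
    within the unexplored set [U], so [Ex_nbh_power] applies. The factor exp(-(theta + b)|B|) from
    [step_factor_le] compensates the gain exp(b|B|) and leaves exp(-theta|B|). *)
Lemma pot_step A j :
  Ex p (fun G : graph n => pot (bfs (adj G) A j.+1)) <=
  Ex p (fun G : graph n => pot (bfs (adj G) A j)).
Proof.
have p01 := edge_prob01; have [th0 th1] := andP theta01.
pose f (s : {set 'I_n} * {set 'I_n}) (G : graph n) :=
  pot (s.1 :|: s.2, nbh (adj G) s.2 :\: (s.1 :|: s.2)).
apply: (Ex_cond (X := fun G => bfs (adj G) A j) (f := f) (g := fun s _ => pot s)).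
case=> S B; have [dSB|nd] := boolP [disjoint S & B]; last first.
  rewrite le_eqVlt; apply/orP; left; apply/eqP/eq_Ex => G.
  rewrite [_ == _](_ : _ = false) ?mul0r //; apply: contraNF nd => /eqP eS.
  by have := bfs_disjoint (adj G) A j; rewrite eS.
set U := ~: (S :|: B).
have dBU : [disjoint B & U] by rewrite disjoints_subset setCK subsetUr.
have cSB : #|S :|: B|%:R = #|S|%:R + #|B|%:R :> R.
  by rewrite cardsU (eqP (_ : S :&: B == set0)) ?setI_eq0 // cards0 subn0 natrD.
(* If the next explored set is above theta n, the potential is killed and the next value is 0. *)
have [small|big] := boolP (#|S :|: B|%:R <= theta * n%:R); last first.
  apply: Ex_le => // G; rewrite /f /pot /= (negPf big) mulr0 mulr0.
  by rewrite !mulr_ge0 ?expR_ge0.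
have -> : Ex p (fun G : graph n => (bfs (adj G) A j == (S, B))%:R * f (S, B) G) =
    expR (b * #|S :|: B|%:R) * Ex p (fun G : graph n => (bfs (adj G) A j == (S, B))%:R *
      expR (- theta) ^+ #|nbh (adj G) B :&: U|).
  rewrite -ExZ; apply: eq_Ex => G; rewrite /f /pot /= small mulr1 mulrCA; congr (_ * _).
  by rewrite -expRM_natl -expRD setDE -/U [- theta * _]mulrC addrC.
rewrite Ex_nbh_power //; last first.
  move=> v G; rewrite !inE negb_or => /andP[vS vB]; rewrite bfs_edge_cut //.
  by rewrite disjoint_sym disjoints1.
have -> : Ex p (fun G : graph n => (bfs (adj G) A j == (S, B))%:R * pot (S, B)) =
   pot (S, B) * Ex p (fun G : graph n => (bfs (adj G) A j == (S, B))%:R).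
  by rewrite -ExZ; apply: eq_Ex => G; rewrite mulrC.
rewrite mulrA; apply: ler_wpM2r; first by apply: Ex_ge0.
have S0 : 0 <= #|S|%:R :> R by []. have B0 : 0 <= #|B|%:R :> R by [].
have -> : pot (S, B) = expR (- theta * #|B|%:R + b * #|S|%:R).
  by rewrite /pot /= (_ : _ <= _) ?mulr1 //; lra.
apply: le_trans (ler_wpM2l (expR_ge0 _) (step_factor_le _ _)) _.
- by lra.
- have : #|S :|: B|%:R + #|U|%:R = n%:R :> R.
    by rewrite -natrD cardsC card_ord.
  lra.
by rewrite -expRD ler_expR cSB le_eqVlt; apply/orP; left; apply/eqP; ring.
Qed.

Lemma pot_le A j : Ex p (fun G : graph n => pot (bfs (adj G) A j)) <= expR (- theta * #|A|%:R).
Proof.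
elim: j => [|j IHj]; last exact: le_trans (pot_step A j) IHj.
have [th0 _] := andP theta01.
rewrite (@eq_Ex _ _ _ _ (fun=> expR (- theta * #|A|%:R))) ?Ex_const // => G.
by rewrite /pot /= cards0 mulr0 addr0 mulr_ge0 ?mulr1 // ltW.
Qed.

(** The last condition says that the next explored set is at most [rho] times the present one:
    growth fails while the size is between [m] and theta n. *)
Definition stunted (m : R) (s : {set 'I_n} * {set 'I_n}) : bool :=
  [&& m <= #|s.1|%:R, #|s.1|%:R <= theta * n%:R & #|s.2|%:R <= (rho - 1) * #|s.1|%:R].

(** In a stunted state the exponent of [pot] is at least theta^2 |s.1| >= theta^2 m, while its mean
    never exceeds 1; Markov's inequality concludes. *)
Lemma stunted_prob_le m x j :
  Ex p (fun G : graph n => (stunted m (bfs (adj G) [set x] j))%:R) <= expR (- (theta ^+ 2 * m)).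
Proof.
have p01 := edge_prob01; have [th0 th1] := andP theta01.
apply: le_trans (Ex_markov p01 (c := expR (theta ^+ 2 * m))
  (F := fun G => pot (bfs (adj G) [set x] j)) _ _ _) _.
- exact: expR_gt0.
- by move=> G; rewrite mulr_ge0 ?expR_ge0.
- move=> G /and3P[lem small few]; rewrite /pot small mulr1 ler_expR expr2.
  move: few lem; set s2 := _%:R; set s1 := _%:R => few lem.
  have : 0 <= theta * theta by nra.
  have : theta * s2 <= theta * ((rho - 1) * s1) by rewrite ler_pM2l.
  nra.
rewrite ler_pdivrMr ?expR_gt0 // -expRD addNr expR0.
apply: le_trans (pot_le _ _) _; rewrite -[leRHS]expR0 ler_expR cards1; lra.
Qed.

(** When the exploration dies before being killed, [pot] is at least 1, whereas it starts at
    exp(-theta|A|). *)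
Lemma small_extinct_prob_le A j :
  Ex p (fun G : graph n => (((bfs (adj G) A j).2 == set0) &&
     (#|(bfs (adj G) A j).1|%:R <= theta * n%:R)%R)%:R) <= expR (- theta * #|A|%:R).
Proof.
have p01 := edge_prob01; have [th0 th1] := andP theta01.
apply: le_trans (pot_le A j); apply: Ex_le => // G; rewrite /pot.
case: andP => [[/eqP -> ->]|_]; last by rewrite mulr_ge0 ?expR_ge0.
rewrite cards0 mulr0 add0r mulr1; apply: le_trans (expR_ge1Dx _); rewrite lerDl.
apply: mulr_ge0 => //; apply: mulr_ge0; first by lra.
by have := rho1; lra.
Qed.

Lemma level_mean_le x j :
  Ex p (fun G : graph n => #|(bfs (adj G) [set x] j).2|%:R) <= lambda ^+ j.
Proof.
have p01 := edge_prob01; have [l0 _] := andP lambdan.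
have pn : p * n%:R = lambda by rewrite divfK // gt_eqF.
elim: j => [|j IHj].
  by rewrite (@eq_Ex _ _ _ _ (fun=> 1)) ?Ex_const // => G /=; rewrite cards1.
rewrite exprS; apply: le_trans (ler_wpM2l (ltW l0) IHj); rewrite -ExZ.
pose f (s : {set 'I_n} * {set 'I_n}) (G : graph n) : R :=
  #|nbh (adj G) s.2 :\: (s.1 :|: s.2)|%:R.
apply: (Ex_cond (X := fun G => bfs (adj G) [set x] j) (f := f)
  (g := fun s _ => lambda * #|s.2|%:R)).
case=> S B; have [dSB|nd] := boolP [disjoint S & B]; last first.
  rewrite le_eqVlt; apply/orP; left; apply/eqP/eq_Ex => G.
  rewrite [_ == _](_ : _ = false) ?mul0r //; apply: contraNF nd => /eqP eS.
  by have := bfs_disjoint (adj G) [set x] j; rewrite eS.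
have dBU : [disjoint B & ~: (S :|: B)] by rewrite disjoints_subset setCK subsetUr.
under eq_Ex do rewrite /f /= setDE.
apply: le_trans (Ex_nbh_card p01 dBU _ _) _ => //.
  move=> v G; rewrite !inE negb_or => /andP[vS vB]; rewrite bfs_edge_cut //.
  by rewrite disjoint_sym disjoints1.
under [leRHS]eq_Ex do rewrite mulrC.
rewrite ExZ; apply: ler_wpM2r; first by apply: Ex_ge0.
rewrite [leLHS]mulrAC; apply: ler_wpM2r => //; rewrite -[leRHS]pn; apply: ler_wpM2l; first by case/andP: p01.
by rewrite ler_nat -[leqRHS]card_ord max_card.
Qed.
End Drift.

(** * Distances between two vertices *)

Section Distances.
Variables (R : realType) (n : nat) (lambda rho theta : R).
Hypotheses (n0 : (0 < n)%N) (lambdan : 0 < lambda <= n%:R).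
Hypotheses (theta01 : 0 < theta < 1) (rho1 : 1 < rho)
  (drift : (rho + theta) * (1 + lambda * theta) * (1 + theta) <= (1 - theta) * lambda).

Notation p := (lambda / n%:R).
Notation mu := ((rho - 1) / (2 * rho)).
Notation stunt := (stunted rho theta).

(** At the first [j] where the explored set passes [t], the previous set is either below
    [m <= t / 2], so the level exceeds [t / 2], or not stunted, so the level is at least (rho - 1) /
    rho times [t]. Both exceed [mu * t]. *)
Lemma large_level (e : rel 'I_n) A (t m : R) J :
  0 <= t <= theta * n%:R -> 2 * m <= t ->
  (forall j, (j <= J)%N -> ~~ stunt m (bfs e A j)) ->
  t < #|(bfs e A J.+1).1|%:R -> exists2 j, (j <= J)%N & mu * t <= #|(bfs e A j).2|%:R.
Proof.
move=> /andP[t0 tn] mt nst large; have rho_gt1 := rho1.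
pose P j := t < #|(bfs e A j.+1).1|%:R.
have exP : exists j, P j by exists J.
case: (ex_minnP exP) => j Pj minj; exists j; first exact: minj.
have small : #|(bfs e A j).1|%:R <= t.
  case: j Pj minj => [|j] _ minj; first by rewrite cards0.
  by rewrite leNgt; apply/negP => /minj; rewrite ltnn.
have := nst j (minj _ large); rewrite /stunted (le_trans small tn) /= negb_and -!ltNge.
move: Pj; rewrite /P card_bfsS1 natrD; move: small.
have := ler0n R #|(bfs e A j).2|; move: (#|(bfs e A j).1|%:R) (#|(bfs e A j).2|%:R) => s a a0 small large_j.
have rho2 : 0 < 2 * rho by lra.
rewrite mulrAC ler_pdivrMr // => /orP[] few.
  have : 0 <= rho * (2 * a - t) by apply: mulr_ge0; lra.
  lra.
have : 0 <= (rho - 1) * (s + a - t) by apply: mulr_ge0; lra.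
have : 0 <= rho * a by apply: mulr_ge0; lra.
lra.
Qed.

(** Survival to level [r] already gives [r.+1 >= m] vertices. Without stunting, [l] further steps
    below theta n would yield at least [rho ^+ l > n] vertices. *)
Lemma alive_large (e : rel 'I_n) A (m : R) r l :
  m <= r.+1%:R -> n%:R < rho ^+ l -> (bfs e A r).2 != set0 ->
  (forall j, (j <= r + l)%N -> ~~ stunt m (bfs e A j)) ->
  theta * n%:R < #|(bfs e A (r + l).+1).1|%:R.
Proof.
move=> mr nl alive nst; have rho_gt1 := rho1; rewrite ltNge; apply/negP => small.
suff H i : (i <= l)%N -> rho ^+ i <= #|(bfs e A (r + i).+1).1|%:R.
  have := lt_le_trans nl (H l (leqnn _)); rewrite ltr_nat.
  by rewrite ltnNge -[X in (_ <= X)%N]card_ord max_card.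
have ger : (r < #|(bfs e A r.+1).1|)%N by apply: bfs_alive_size.
elim: i => [_|i IHi lti].
  by rewrite expr0 addn0 ler1n; apply: leq_ltn_trans ger.
have := nst (r + i).+1; rewrite -addnS leq_add2l lti => /(_ isT).
have mono j : (r.+1 <= j <= (r + l).+1)%N -> (m <= #|(bfs e A j).1|%:R) && (#|(bfs e A j).1|%:R <= theta * n%:R).
  move=> /andP[rj jl]; apply/andP; split.
    apply: le_trans mr _; rewrite ler_nat; apply: leq_trans ger _.
    exact/subset_leq_card/bfs1_mono.
  apply: le_trans small; rewrite ler_nat.
  exact/subset_leq_card/bfs1_mono.
rewrite /stunted andbA mono /=; last by lia.
rewrite -ltNge addnS => few; have rho0 : 0 <= rho by lra.
have := ler_wpM2l rho0 (IHi (ltnW lti)).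
rewrite exprS (card_bfsS1 _ _ (r + i).+1) natrD; move: few.
move: (#|(bfs _ _ _).1|%:R) (#|(bfs _ _ _).2|%:R) => s a; lra.
Qed.

Definition sep (A B : R) (s s' : {set 'I_n} * {set 'I_n}) (G : graph n) : bool :=
  [&& A <= #|s.2|%:R, B <= #|s'.2|%:R, [disjoint s.1 :|: s.2 & s'.1 :|: s'.2]
    & [disjoint G & edge_cut s.2 s'.2]].

(** Given both explorations, the edges between their last levels are unexposed: these levels are
    disjoint from both inner sets. All of them are absent with probability at most
    exp(-p|C||C'|). *)
Lemma sep_prob_le A B x y i j : 0 <= A -> 0 <= B ->
  Ex p (fun G : graph n => (sep A B (bfs (adj G) [set x] i) (bfs (adj G) [set y] j) G)%:R)
  <= expR (- (p * (A * B))).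
Proof.
move=> A0 B0; have p01 := edge_prob01 n0 lambdan.
rewrite -[leRHS](Ex_const (vpair n : finType) p).
apply: (Ex_cond (X := fun G => (bfs (adj G) [set x] i, bfs (adj G) [set y] j))
  (f := fun v G => (sep A B v.1 v.2 G)%:R) (g := fun _ _ => expR (- (p * (A * B))))).
case=> -[S C] [S' C']; set c := [&& A <= #|C|%:R, B <= #|C'|%:R & [disjoint S :|: C & S' :|: C']].
set ind := fun G : graph n => ((bfs (adj G) [set x] i, bfs (adj G) [set y] j) == ((S, C), (S', C')))%:R : R.
have [cT|cF] := boolP c; last first.
  apply: Ex_le => // G /=; have -> : sep A B (S, C) (S', C') G = false.
    by apply: contraNF cF => /and4P[h1 h2 h3 _]; apply/and3P.
  by rewrite mulr0 mulr_ge0 ?expR_ge0.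
have [leA leB dis] := and3P cT.
have sub (X Y : {set 'I_n}) : X \subset S :|: C -> Y \subset S' :|: C' -> [disjoint X & Y].
  by move=> sX sY; apply: (disjointWl sX); apply: (disjointWr sY).
have [dSC|nd] := boolP ([disjoint S & C] && [disjoint S' & C']); last first.
  apply: Ex_le => // G; rewrite [_ == _](_ : _ = false) ?mul0r //.
  apply: contraNF nd => /eqP[eS eS'].
  have := bfs_disjoint (adj G) [set x] i; have := bfs_disjoint (adj G) [set y] j.
  by rewrite eS eS' => -> ->.
have [dS dS'] := andP dSC.
have -> : Ex p (fun G => ind G * (sep A B (S, C) (S', C') G)%:R) =
   Ex p (fun G => ind G * [disjoint G & edge_cut C C']%:R).
  by apply: eq_Ex => G; rewrite /sep /= leA leB dis.
rewrite Ex_disjoint => [|G]; last first.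
  by rewrite /ind !xpair_eqE !bfs_edge_cut //;
    solve [rewrite sub ?subsetUl ?subsetUr // | rewrite disjoint_sym sub ?subsetUl ?subsetUr //].
rewrite mulrC; under [leRHS]eq_Ex do rewrite mulrC.
rewrite ExZ [leLHS]mulrC; apply: ler_wpM2r; first exact: Ex_ge0.
rewrite card_edge_cut; last by rewrite sub // subsetUr.
have p0 : 0 <= p by case/andP: p01.
apply: (@le_trans _ _ (expR (- p) ^+ (#|C| * #|C'|))).
  rewrite lerXn2r ?nnegrE ?expR_ge0 //; first by rewrite subr_ge0; case/andP: p01.
  exact: expR_ge1Dx.
rewrite -expRM_natl ler_expR mulrN lerN2 natrM mulrC; apply: ler_wpM2r => //.
exact: ler_pM.
Qed.

(** Union bound over levels. If no level is stunted, [x] has a level of size mu theta n up to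
    [r + l] and [y] one of size mu r up to [r]; being far, they are separated, and p (mu theta n)(mu
    r) = lambda mu^2 theta r. *)
Lemma far_pair_prob_le (x y : 'I_n) r l : r%:R <= theta * n%:R -> n%:R < rho ^+ l ->
  Ex p (fun G : graph n => (connect (adj G) x y && ~~ `[< reach (adj G) (r + (r + l)).+1 x y >])%:R)
  <= 2 * (r + l).+1%:R * expR (- (theta ^+ 2 / 2 * r%:R))
     + (r + l).+1%:R ^+ 2 * expR (- (lambda * mu ^+ 2 * theta * r%:R)).
Proof.
move=> rn nl; have p01 := edge_prob01 n0 lambdan; set J := (r + l)%N; have rho_gt1 := rho1.
have [th0 th1] := andP theta01; have [l0 _] := andP lambdan.
have nR0 : 0 < n%:R :> R by rewrite ltr0n.
have mu0 : 0 <= mu by apply: divr_ge0; lra.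
(* This threshold meets both [m <= r.+1] for [alive_large] and [2 * m <= t] for [large_level] with
   [t] equal to theta n or to [r]. *)
pose m : R := r%:R / 2.
pose st (z : 'I_n) (G : graph n) (j : 'I_J.+1) : R := (stunt m (bfs (adj G) [set z] j))%:R.
pose sp G (j i : 'I_J.+1) : R := (sep (mu * (theta * n%:R)) (mu * r%:R) (bfs (adj G) [set x] j) (bfs (adj G) [set y] i) G)%:R.
apply: (@le_trans _ _ (Ex p (fun G => (\sum_j st x G j + \sum_j st y G j) + \sum_j \sum_i sp G j i))).
  apply: Ex_le => // G.
  have sum0 z : 0 <= \sum_j st z G j by apply: sumr_ge0.
  have sp0 : 0 <= \sum_j \sum_i sp G j i by apply: sumr_ge0 => j _; apply: sumr_ge0.
  case: andP => [[cxy /asboolPn far]|_]; last by rewrite !addr_ge0.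
  rewrite mulr1n.
  have alive z w : connect (adj G) z w -> ~ reach (adj G) (r + J).+1 z w ->
      (bfs (adj G) [set z] r).2 != set0.
    by move=> czw fzw; apply: alive_of_not_reach czw fzw _; rewrite leqW // leq_addr.
  have ax := alive _ _ cxy far.
  have ay : (bfs (adj G) [set y] r).2 != set0.
    apply: (alive y x); last by move=> /(reach_sym (@adj_sym _ G)).
    by rewrite (sym_connect_sym (@adj_sym _ G)).
  have one z : (exists2 j, (j <= J)%N & stunt m (bfs (adj G) [set z] j)) ->
      1 <= \sum_j st z G j.
    move=> [j leJ sj]; rewrite (bigD1 (Ordinal (leJ : (j < J.+1)%N))) //= {1}/st /= sj.
    by rewrite lerDl sumr_ge0.
  have [sx|nx] := pselect (exists2 j, (j <= J)%N & stunt m (bfs (adj G) [set x] j)).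
    by have := one _ sx; have := sum0 y; lra.
  have [sy|ny] := pselect (exists2 j, (j <= J)%N & stunt m (bfs (adj G) [set y] j)).
    by have := one _ sy; have := sum0 x; lra.
  have {}nx j : (j <= J)%N -> ~~ stunt m (bfs (adj G) [set x] j).
    by move=> leJ; apply/negP => sj; apply: nx; exists j.
  have {}ny j : (j <= J)%N -> ~~ stunt m (bfs (adj G) [set y] j).
    by move=> leJ; apply/negP => sj; apply: ny; exists j.
  have r0 : 0 <= r%:R :> R by [].
  have [j jJ bigx] : exists2 j, (j <= J)%N & mu * (theta * n%:R) <= #|(bfs (adj G) [set x] j).2|%:R.
    apply: (large_level (m := m) _ _ nx).
    - by rewrite lexx andbT mulr_ge0 // ltW.
    - by rewrite /m; lra.
    apply: (alive_large (m := m)) => //.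
    by rewrite /m -[r.+1%:R]natr1; lra.
  have [i ir bigy] : exists2 i, (i <= r)%N & mu * r%:R <= #|(bfs (adj G) [set y] i).2|%:R.
    apply: (large_level (m := m)).
    - by rewrite r0 rn.
    - by rewrite /m; lra.
    - by move=> i ir; apply: ny; rewrite (leq_trans ir) // leq_addr.
    by rewrite ltr_nat; apply: bfs_alive_size.
  have [|dis nadj] := @meeting _ (adj G) i j x y (@adj_sym _ G).
    by move=> wxy; apply: far; apply: reach_mono wxy; rewrite ltnS leq_add.
  have iJ : (i < J.+1)%N by rewrite ltnS (leq_trans ir) // leq_addr.
  suff : 1 <= \sum_j \sum_i sp G j i by have := sum0 x; have := sum0 y; lra.
  rewrite (bigD1 (Ordinal (jJ : (j < J.+1)%N))) //= (bigD1 (Ordinal iJ)) //=.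
  rewrite {1}/sp /sep /= bigx bigy -!bfsS1 dis disjoint_edge_cut.
  have -> /= : [forall a in (bfs (adj G) [set x] j).2, forall w in (bfs (adj G) [set y] i).2, ~~ adj G a w].
    by apply/forall_inP => a aA; apply/forall_inP => w wA; apply: nadj.
  by rewrite -addrA lerDl addr_ge0 ?sumr_ge0 // => k _; rewrite sumr_ge0.
have cst (c : R) : \sum_(j < J.+1) c = J.+1%:R * c.
  by rewrite sumr_const card_ord mulr_natl.
rewrite !ExD !Ex_sum; apply: lerD.
  have le_st z : \sum_j Ex p (fun G => st z G j) <= J.+1%:R * expR (- (theta ^+ 2 / 2 * r%:R)).
    rewrite -cst; apply: ler_sum => j _.
    have -> : theta ^+ 2 / 2 * r%:R = theta ^+ 2 * m by rewrite /m mulrAC mulrA.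
    exact: stunted_prob_le.
  by apply: le_trans (lerD (le_st x) (le_st y)) _; rewrite -mulrDl mulr_natl mulr2n.
rewrite expr2 -mulrA -cst.
apply: ler_sum => j _; rewrite Ex_sum -cst.
apply: ler_sum => i _; apply: le_trans (sep_prob_le _ _ _ _ _ _) _.
- by rewrite mulr_ge0 // mulr_ge0 // ltW.
- by rewrite mulr_ge0.
rewrite ler_expR lerN2 le_eqVlt; apply/orP; left; apply/eqP.
by field; rewrite gt_eqF //=; lra.
Qed.

End Distances.

(** * Average hyperbolicity and distance deviations *)

Section AverageHyperbolicity.
Variables (R : realType) (T : finType) (e : rel T).

Lemma max3_med3 a b c : (max3 a b c, med3 a b c) \in
  [:: (a, b); (b, a); (a, c); (c, a); (b, c); (c, b)].
Proof.
rewrite /max3 /med3 /sort /= /merge /=; rewrite !inE !xpair_eqE.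
by case: (leqP a b) => ab; case: (leqP b c) => bc; case: (leqP a c) => ac //=;
  rewrite ?(ltnW ab) ?eqxx /= ?orbT //; lia.
Qed.

(** Each of the three sums is within two deviations of [2 * m], and the maximum and the median are
    two different ones among them, so [2 * m] cancels. *)
Lemma fp_le_dev (m : R) x y z w (D := fun x y => `|(gdist e x y)%:R - m|) :
  fp e R x y z w <= (D x y + D z w + D x z + D y w + D x w + D y z) / 2.
Proof.
rewrite /fp ler_wpM2r ?invr_ge0 //.
have H a b : (a + b)%N%:R - 2 * m <= `|a%:R - m| + `|b%:R - m| /\
             2 * m - (a + b)%N%:R <= `|a%:R - m| + `|b%:R - m|.
  have := ler_norm (a%:R - m); have := ler_norm (b%:R - m).
  have := ler_norm (- (a%:R - m)); have := ler_norm (- (b%:R - m)).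
  by rewrite !normrN natrD; lra.
have D0 u v : 0 <= D u v by apply: normr_ge0.
have [P1 P2] := H (gdist e x y) (gdist e z w).
have [Q1 Q2] := H (gdist e x z) (gdist e y w).
have [S1 S2] := H (gdist e x w) (gdist e y z).
have := max3_med3 (gdist e x y + gdist e z w) (gdist e x z + gdist e y w) (gdist e x w + gdist e y z).
have := (D0 x y, D0 z w, D0 x z, D0 y w, D0 x w, D0 y z).
rewrite !inE !xpair_eqE => -[[[[[d1 d2] d3] d4] d5] d6].
rewrite /D in d1 d2 d3 d4 d5 d6 *.
by move=> /orP[|/orP[|/orP[|/orP[|/orP[]]]]] /andP[/eqP -> /eqP ->]; lra.
Qed.

Lemma avg_hyp_le_dev (m : R) : (0 < #|T|)%N ->
  avg_hyp e R <= 3 * (\sum_(x : T) \sum_(y : T) `|(gdist e x y)%:R - m|) / #|T|%:R ^+ 2.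
Proof.
move=> T0; set D : T -> T -> R := fun x y => `|(gdist e x y)%:R - m|.
set N : R := #|T|%:R; have N0 : 0 < N by rewrite ltr0n.
have cst (c : R) : \sum_(x : T) c = N * c by rewrite sumr_const mulr_natl.
set S : R := \sum_x \sum_y _.
rewrite /avg_hyp ler_pdivrMr ?exprn_gt0 //.
have -> : 3 * S / N ^+ 2 * N ^+ 4 = 3 * S * N ^+ 2 by field; rewrite gt_eqF.
apply: (@le_trans _ _ (\sum_x \sum_y \sum_z \sum_w
   (D x y + D z w + D x z + D y w + D x w + D y z) / 2)).
  do 4 (apply: ler_sum => ? _); exact: fp_le_dev.
(* Each pass sums out one variable. In the end each of the six pairs contributes N^2 S, and 6 / 2
   gives the constant 3. *)
under eq_bigr => x _ do under eq_bigr => y _ do under eq_bigr => z _ do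
  rewrite -big_distrl /= !big_split /= !cst.
under eq_bigr => x _ do under eq_bigr => y _ do
  rewrite -big_distrl /= !big_split /= !cst -!big_distrr /= -/S.
under eq_bigr => x _ do
  rewrite -big_distrl /= !big_split /= !cst -!big_distrr /= -/S.
rewrite -big_distrl /= !big_split /= !cst -!big_distrr /= -/S.
by rewrite le_eqVlt; apply/orP; left; apply/eqP; field.
Qed.

End AverageHyperbolicity.

(** * Distances inside a component *)

Section InducedDistances.
Variables (T : finType) (e : rel T) (C : {set T}).
Hypotheses (e_sym : symmetric e) (compC : C \in components e).

Lemma component_closed x y : x \in C -> e x y -> y \in C.
Proof.
have /imsetP[z _ ->] := compC; rewrite !inE => czx /connect1.
exact: connect_trans.
Qed.

Lemma component_connect x y : x \in C -> y \in C -> connect e x y.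
Proof.
have /imsetP[z _ ->] := compC; rewrite !inE => czx; apply: connect_trans.
by rewrite (sym_connect_sym e_sym).
Qed.

Lemma induced_path (u : {x | x \in C}) p : path e (val u) p ->
  exists q, path (induced_rel e C) u q /\ map val q = p.
Proof.
elim: p u => [|y p IHp] u /=; first by exists [::].
move=> /andP[euy ep].
have yC := component_closed (valP u) euy.
have [q [eq mq]] := IHp (exist _ y yC) ep.
by exists (exist _ y yC :: q); rewrite /= mq eq andbT.
Qed.

(** Walks that start in a component stay in it, so the induced distance is that of the whole
    graph. *)
Lemma gdist_le_reach k (u v : {x | x \in C}) :
  (gdist (induced_rel e C) u v <= k)%N <-> reach e k (val u) (val v).
Proof.
split=> [le|[p [/induced_path[q [eq <-]] lq sq]]]; last first.
  apply: leq_trans sq; rewrite size_map; apply: gdist_le => //.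
  by apply: val_inj; rewrite -lq last_map.
have : connect (induced_rel e C) u v.
  have /connectP[p /induced_path[q [eq <-]] lq] := component_connect (valP u) (valP v).
  by apply/connectP; exists q => //; apply: val_inj; rewrite lq last_map.
move=> /gdist_attained[p [ep lp sp]]; exists (map val p).
by rewrite last_map lp size_map sp path_map.
Qed.

Lemma ler_sum_sig (R : realType) (F : T -> R) : (forall x, 0 <= F x) ->
  \sum_(u : {x | x \in C}) F (val u) <= \sum_(x : T) F x.
Proof.
move=> F0; rewrite -(big_imset F (h := val)) /=; last by move=> u v _ _; apply: val_inj.
by rewrite big_mkcond; apply: ler_sum => x _; case: ifP.
Qed.

(** Deviations are taken from [m2]: at most [m2 - m1] for typical pairs, [m2] for near pairs, and
    [k] for far ones, since [k] bounds the diameter. Exceptional pairs are counted over the whole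
    graph, which makes their number independent of the choice of [C]. *)
Lemma avg_hyp_component_le (R : realType) (m1 m2 k : nat) : (m1 <= m2)%N -> (0 < #|C|)%N ->
  (forall x y, connect e x y -> reach e k x y) ->
  avg_hyp (induced_rel e C) R <= 3 * ((m2%:R - m1%:R) +
    (m2%:R * (\sum_x \sum_y (`[< reach e m1 x y >])%:R)
     + k%:R * (\sum_x \sum_y (connect e x y && ~~ `[< reach e m2 x y >])%:R)) / #|C|%:R ^+ 2).
Proof.
move=> m12 C0 diam.
have cT : #|{: {x | x \in C}}| = #|C| by rewrite card_sig.
apply: le_trans (avg_hyp_le_dev _ m2%:R _) _; first by rewrite cT.
rewrite cT -mulrA; apply: ler_wpM2l => //.
set N : R := #|C|%:R; have N0 : 0 < N by rewrite ltr0n.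
rewrite ler_pdivrMr ?exprn_gt0 // mulrDl divfK ?expf_neq0 ?gt_eqF //.
pose F x y : R := m2%:R * (`[< reach e m1 x y >])%:R +
   k%:R * (connect e x y && ~~ `[< reach e m2 x y >])%:R.
have F0 x y : 0 <= F x y by rewrite addr_ge0 // mulr_ge0.
have m12R : m1%:R <= m2%:R :> R by rewrite ler_nat.
apply: (@le_trans _ _ (\sum_(u : {x | x \in C}) \sum_(v : {x | x \in C})
   ((m2%:R - m1%:R) + F (val u) (val v)))).
  apply: ler_sum => u _; apply: ler_sum => v _.
  have cuv := component_connect (valP u) (valP v).
  set d := gdist _ u v; have dk : (d <= k)%N by apply/gdist_le_reach/diam.
  have [d2|d2] := leqP d m2; last first.
    have far : ~~ `[< reach e m2 (val u) (val v) >].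
      by apply/asboolPn => /gdist_le_reach; rewrite leqNgt d2.
    have dR : m2%:R <= d%:R :> R by rewrite ler_nat ltnW.
    have dkR : d%:R <= k%:R :> R by rewrite ler_nat.
    rewrite ger0_norm ?subr_ge0 // /F far cuv mulr1n mulr1.
    have : 0 <= m2%:R * (`[< reach e m1 (val u) (val v) >])%:R :> R by rewrite mulr_ge0.
    have : 0 <= m2%:R :> R by [].
    lra.
  have d2R : d%:R <= m2%:R :> R by rewrite ler_nat.
  rewrite distrC ger0_norm ?subr_ge0 //.
  have [d1|d1] := leqP d m1; last first.
    have : m1%:R <= d%:R :> R by rewrite ler_nat ltnW.
    by have := F0 (val u) (val v); lra.
  have near : `[< reach e m1 (val u) (val v) >] by apply/asboolP/gdist_le_reach.
  rewrite /F near mulr1n mulr1.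
  have : 0 <= k%:R * (connect e (val u) (val v) && ~~ `[< reach e m2 (val u) (val v) >])%:R :> R.
    by rewrite mulr_ge0.
  have : 0 <= d%:R :> R by [].
  lra.
have cst (c : R) : \sum_(u : {x | x \in C}) c = c * N by rewrite sumr_const cT mulr_natr.
under eq_bigr => u _ do rewrite big_split /= cst.
rewrite big_split /= cst -mulrA -expr2; apply: lerD => //.
apply: (@le_trans _ _ (\sum_x \sum_y F x y)).
  apply: le_trans (ler_sum_sig (F := fun x => \sum_y F x y) _); last first.
    by move=> x; apply: sumr_ge0.
  by apply: ler_sum => u _; apply: (ler_sum_sig (F := F (val u))).
rewrite !big_distrr /= -big_split /=; apply: ler_sum => x _.
by rewrite !big_distrr /= -big_split.
Qed.

End InducedDistances.

(** * Failure probability for fixed n *)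

Lemma er_probE (R : realType) (n : nat) (p : R) (P : pred (graph n)) :
  er_prob p P = Ex p (fun G => (P G)%:R).
Proof.
rewrite /er_prob big_mkcond; apply: eq_bigr => G _.
by case: ifP; rewrite ?mulr1 ?mulr0.
Qed.

Section FailureBound.
Variables (R : realType) (n : nat) (lambda rho theta : R).
Hypotheses (n0 : (0 < n)%N) (lambdan : lambda <= n%:R) (lambda1 : 1 <= lambda).
Hypotheses (theta01 : 0 < theta < 1) (rho1 : 1 < rho)
  (drift : (rho + theta) * (1 + lambda * theta) * (1 + theta) <= (1 - theta) * lambda).

Notation p := (lambda / n%:R).
Notation mu := ((rho - 1) / (2 * rho)).

Let lambdan' : 0 < lambda <= n%:R.
Proof. by rewrite lambdan andbT (lt_le_trans ltr01). Qed.

Let nR0 : 0 < n%:R :> R. Proof. by rewrite ltr0n. Qed.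

Definition far_bound (r l : nat) : R :=
  2 * (r + l).+1%:R * expR (- (theta ^+ 2 / 2 * r%:R))
  + (r + l).+1%:R ^+ 2 * expR (- (lambda * mu ^+ 2 * theta * r%:R)).

Definition far_pairs (k : nat) (G : graph n) : R :=
  \sum_x \sum_y (connect (adj G) x y && ~~ `[< reach (adj G) k x y >])%:R.

Definition near_pairs (k : nat) (G : graph n) : R :=
  \sum_x \sum_y (`[< reach (adj G) k x y >])%:R.

Lemma far_pairs_mean_le r l : r%:R <= theta * n%:R -> n%:R < rho ^+ l ->
  Ex p (far_pairs (r + (r + l)).+1) <= n%:R ^+ 2 * far_bound r l.
Proof.
move=> rn nl; have cst (c : R) : \sum_(x < n) c = n%:R * c.
  by rewrite sumr_const card_ord mulr_natl.
rewrite Ex_sum expr2 -mulrA -cst; apply: ler_sum => x _.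
rewrite Ex_sum -cst; apply: ler_sum => y _.
exact: far_pair_prob_le n0 lambdan' theta01 rho1 drift _ _ _ _ rn nl.
Qed.

Lemma near_pairs_mean_le k : Ex p (near_pairs k) <= n%:R * (k.+1%:R * lambda ^+ k).
Proof.
have -> : n%:R * (k.+1%:R * lambda ^+ k) = \sum_(x < n) \sum_(j < k.+1) lambda ^+ k.
  by rewrite !sumr_const !card_ord !mulr_natl.
rewrite Ex_sum; apply: ler_sum => x _.
have card_ball e : \sum_y (`[< reach e k x y >])%:R =
    \sum_(j < k.+1) #|(bfs e [set x] j).2|%:R :> R.
  have -> : \sum_(j < k.+1) #|(bfs e [set x] j).2|%:R = #|(bfs e [set x] k.+1).1|%:R :> R.
    elim: k.+1 => [|j IHj]; first by rewrite big_ord0 cards0.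
    by rewrite big_ord_recr card_bfsS1 natrD IHj.
  rewrite -sum1_card natr_sum [RHS]big_mkcond; apply: eq_bigr => y _.
  have -> : (y \in (bfs e [set x] k.+1).1) = `[< reach e k x y >].
    apply/idP/asboolP => [/bfs1_reach[_ /set1P -> //]|w].
    by apply/bfs1_reach; exists x; rewrite ?inE.
  by case: asboolP.
under eq_Ex do rewrite card_ball.
rewrite Ex_sum; apply: ler_sum => j _.
apply: le_trans (level_mean_le n0 lambdan' _ _) _.
by apply: ler_weXn2l => //; rewrite -ltnS.
Qed.

(** Four bad events: the exploration from [k] sources dies small, more than a fraction [tau] of
    pairs is far, some component has diameter above [K], or more than a fraction [tau] of pairs is
    near. Otherwise theta n < k|C|, so tau n^2 exceptional pairs are at most tau (k / theta)^2 times
    |C|^2. *)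
Lemma failure_bound (C : graph n -> {set 'I_n}) (X tau : R) (k r0 r1 l m : nat) :
  (forall G, is_largest_component (adj G) (C G)) -> (0 < k <= n)%N -> 0 < tau ->
  r0%:R <= theta * n%:R -> r1%:R <= theta * n%:R -> n%:R < rho ^+ l ->
  (m <= (r0 + (r0 + l)).+1)%N ->
  3 * (((r0 + (r0 + l)).+1%:R - m%:R) +
    tau * ((r0 + (r0 + l)).+1%:R + (r1 + (r1 + l)).+1%:R) * (k%:R / theta) ^+ 2) <= X ->
  1 - er_prob p (fun G => avg_hyp (induced_rel (adj G) (C G)) R <= X) <=
    expR (- theta * k%:R) + far_bound r0 l / tau + n%:R ^+ 2 * far_bound r1 l
    + m.+1%:R * lambda ^+ m / (n%:R * tau).
Proof.
move=> largeC /andP[k0 kn] tau0 r0n r1n nl leM leX.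
have p01 := edge_prob01 n0 lambdan'; have [th0 th1] := andP theta01.
set M := (r0 + (r0 + l)).+1 in leM leX *; set K := (r1 + (r1 + l)).+1 in leX.
pose A : {set 'I_n} := [set x in take k (enum 'I_n)].
have cA : #|A| = k.
  rewrite cardsE (card_uniqP _) ?take_uniq ?enum_uniq // size_take size_enum_ord.
  by case: ltnP => // nk; apply/eqP; rewrite eqn_leq nk kn.
pose H1 (G : graph n) := ((bfs (adj G) A n).2 == set0) &&
     (#|(bfs (adj G) A n).1|%:R <= theta * n%:R).
pose H2 (G : graph n) := tau * n%:R ^+ 2 <= far_pairs M G.
pose H4 (G : graph n) := tau * n%:R ^+ 2 <= near_pairs m G.
have tn0 : 0 < tau * n%:R ^+ 2 by rewrite mulr_gt0 ?exprn_gt0.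
have far0 i G : 0 <= far_pairs i G by apply: sumr_ge0 => x _; apply: sumr_ge0.
have near0 i G : 0 <= near_pairs i G by apply: sumr_ge0 => x _; apply: sumr_ge0.
rewrite er_probE.
apply: (@le_trans _ _ (Ex p (fun G => (((H1 G)%:R + (H2 G)%:R) + far_pairs K G) + (H4 G)%:R))).
  rewrite -[X in X - _](Ex_const (vpair n : finType) p) lerBlDr -ExD; apply: Ex_le => // G.
  have [|bad] := boolP (_ <= X); first by rewrite lerDr !addr_ge0.
  rewrite addr0.
  have [//|h1] := boolP (H1 G); first by rewrite mulr1n -!addrA lerDl !addr_ge0.
  have [//|h2] := boolP (H2 G); first by rewrite mulr1n -!addrA addrCA lerDl !addr_ge0.
  have [//|h4] := boolP (H4 G); first by rewrite mulr1n lerDr !addr_ge0.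
  rewrite add0r add0r addr0.
  (* A single far pair makes [far_pairs K] at least 1, so this count itself bounds the indicator of
     a large diameter. *)
  have [diam|] := pselect (forall x y, connect (adj G) x y -> reach (adj G) K x y); last first.
    move=> /existsNP[x /existsNP[y /not_implyP[cxy nxy]]].
    rewrite /far_pairs (bigD1 x) //= (bigD1 y) //= cxy.
    have -> /= : `[< reach (adj G) K x y >] = false by apply/asboolPn.
    by rewrite -addrA lerDl addr_ge0 ?sumr_ge0 // => z _; rewrite sumr_ge0.
  exfalso; move/negP: bad; apply; apply: le_trans leX.
  have compC : C G \in components (adj G) by case/andP: (largeC G).
  (* After [n] steps the exploration is exhausted; since [H1] fails, it has covered more than theta
     n vertices. *)
  have big : theta * n%:R < (k * #|C G|)%:R.
    rewrite ltNge; apply: contra h1 => small; apply/andP; split.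
      by have := bfs_exhausted (adj G) A; rewrite card_ord => ->.
    apply: le_trans small; rewrite ler_nat -cA.
    exact: card_bfs_le_component.
  have C0 : (0 < #|C G|)%N.
    rewrite lt0n; apply: contraTneq big => ->; rewrite muln0 -leNgt mulr_ge0 // ltW //.
  apply: le_trans (avg_hyp_component_le (@adj_sym _ G) compC R leM C0 diam) _.
  apply: ler_wpM2l => //; rewrite lerD2l.
  set N : R := #|C G|%:R; have N0 : 0 < N by rewrite ltr0n.
  rewrite ler_pdivrMr ?exprn_gt0 //.
  apply: (@le_trans _ _ ((M%:R + K%:R) * (tau * n%:R ^+ 2))).
    rewrite mulrDl; apply: lerD; apply: ler_wpM2l => //; apply: ltW; rewrite ltNge //.
  rewrite [leRHS](_ : _ = (M%:R + K%:R) * (tau * (k%:R * N / theta) ^+ 2)); last first.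
    by field; rewrite gt_eqF.
  apply: ler_wpM2l; first by rewrite addr_ge0.
  rewrite ler_pM2l // lerXn2r ?nnegrE ?ler0n //.
    by rewrite divr_ge0 ?mulr_ge0 // ltW.
  by rewrite ler_pdivlMr // mulrC ltW // -natrM.
rewrite !ExD; apply: lerD; first apply: lerD; first apply: lerD.
- rewrite -cA; exact: small_extinct_prob_le n0 lambdan' theta01 rho1 drift A n.
- apply: le_trans (Ex_markov p01 tn0 (F := far_pairs M) _ _) _ => //.
  rewrite ler_pdivrMr //; apply: le_trans (far_pairs_mean_le r0n nl) _.
  by rewrite le_eqVlt; apply/orP; left; apply/eqP; field; rewrite gt_eqF.
- exact: far_pairs_mean_le.
apply: le_trans (Ex_markov p01 tn0 (F := near_pairs m) _ _) _ => //.
rewrite ler_pdivrMr //; apply: le_trans (near_pairs_mean_le m) _.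
rewrite le_eqVlt; apply/orP; left; apply/eqP; field.
by rewrite !gt_eqF.
Qed.

End FailureBound.

(** * Asymptotics *)

Local Open Scope classical_set_scope.
Local Open Scope ring_scope.

Section Asymptotics.
Variable R : realType.

(** At theta = 0 the inequality is rho <= lambda, so a small theta works. The left side is at most
    rho + 7 lambda^2 theta, and the loss theta lambda on the right costs one more lambda^2 theta,
    whence the 8 in [D]. *)
Lemma drift_parameter (lambda rho : R) : 1 < rho -> rho < lambda ->
  exists2 theta, 0 < theta < 1 &
    (rho + theta) * (1 + lambda * theta) * (1 + theta) <= (1 - theta) * lambda.
Proof.
move=> rho1 rl; set D := 8 * lambda ^+ 2.
have l2 : lambda <= lambda ^+ 2 by rewrite expr2; nra.
have D0 : 0 < D by rewrite /D; lra.
exists ((lambda - rho) / D).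
  by rewrite divr_gt0 ?subr_gt0 // ltr_pdivrMr // /D; lra.
have : (lambda - rho) / D * D = lambda - rho by rewrite divfK // gt_eqF.
have : (lambda - rho) / D < 1 by rewrite ltr_pdivrMr // /D; lra.
have : 0 < (lambda - rho) / D by rewrite divr_gt0 ?subr_gt0.
move: (_ / D) => t t0 t1; rewrite /D => tD.
have h1 : (1 + lambda * t) * (1 + t) <= 1 + 3 * (lambda * t).
  have : 0 <= lambda * t * (1 - t) by apply: mulr_ge0; nra.
  have : 0 <= (lambda - 1) * t by apply: mulr_ge0; lra.
  lra.
have h2 : (rho + t) * (1 + 3 * (lambda * t)) <= rho + 7 * lambda ^+ 2 * t.
  have a1 : t <= lambda ^+ 2 * t by rewrite ler_pMl //; lra.
  have a2 : rho * (lambda * t) <= lambda ^+ 2 * t.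
    by rewrite expr2 -mulrA ler_pM2r ?ltW // mulr_gt0 //; lra.
  have a3 : t * (lambda * t) <= lambda ^+ 2 * t.
    by rewrite expr2 -mulrA ler_pM2r ?mulr_gt0 //; lra.
  lra.
rewrite -mulrA; apply: (@le_trans _ _ ((rho + t) * (1 + 3 * (lambda * t)))).
  by apply: ler_wpM2l h1; lra.
apply: le_trans h2 _.
have : lambda * t <= lambda ^+ 2 * t by apply: ler_wpM2r => //; lra.
lra.
Qed.

Lemma near_ln_ge (A : R) : \forall n \near \oo, A <= ln (n%:R : R).
Proof.
near=> n; have An : expR A <= n%:R.
  by near: n; exact: nbhs_infty_ger.
rewrite -[A]expRK ler_ln ?posrE ?expR_gt0 //.
exact: lt_le_trans (expR_gt0 _) An.
Unshelve. all: by end_near. Qed.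

(** The term of degree [d.+1] in the exponential series beats the power [d]. *)
Lemma ln_pow_decay_cvg (c : R) (d : nat) : 0 < c ->
  (fun n : nat => ln (n%:R : R) ^+ d * expR (- (c * ln n%:R))) @ \oo --> (0 : R).
Proof.
move=> c0; set C := d.+1`!%:R / c ^+ d.+1.
have C0 : 0 < C by rewrite divr_gt0 ?exprn_gt0 // ltr0n fact_gt0.
apply/cvgrPdist_le => e e0; near=> n.
have : C / e + 1 <= ln n%:R by near: n; exact: near_ln_ge.
set L := ln n%:R => Lge.
have Ce : 0 < C / e by rewrite divr_gt0.
have L0 : 0 < L by lra.
rewrite sub0r normrN ger0_norm ?mulr_ge0 ?exprn_ge0 ?expR_ge0 ?(ltW L0) //.
rewrite expRN ler_pdivrMr ?expR_gt0 //.
have cL : 0 <= c * L by rewrite mulr_ge0 // ltW.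
apply: (@le_trans _ _ (e * ((c * L) ^+ d.+1 / d.+1`!%:R))); last first.
  rewrite ler_pM2l //; apply: le_trans (expR_ge1Dxn d cL).
  by rewrite -subr_ge0 addrK.
have -> : e * ((c * L) ^+ d.+1 / d.+1`!%:R) = L ^+ d * (e * L / C).
  rewrite exprMn; have -> : c ^+ d.+1 * L ^+ d.+1 / d.+1`!%:R = L ^+ d.+1 / C.
    by rewrite /C invf_div mulrA [L ^+ _ * _]mulrC.
  by rewrite exprS; move: (L ^+ d) (C^-1) => z y; ring.
rewrite ler_pMr ?exprn_gt0 // ler_pdivlMr // mul1r -ler_pdivrMl // mulrC.
lra.
Unshelve. all: by end_near. Qed.

Lemma truncnS_itv (x : R) : 0 <= x -> x < (Num.truncn x).+1%:R <= x + 1.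
Proof.
move=> /truncn_itv/andP[lo hi]; rewrite hi /= -natr1; lra.
Qed.

End Asymptotics.

(** [c] is a common rate for both exponentials, and [b >= 1] absorbs the linear prefactor: 2b + b^2
    <= 3b^2. *)
Lemma far_bound_le (R : realType) (lambda rho theta c b s : R) (r l : nat) :
  c <= theta ^+ 2 / 2 -> c <= lambda * ((rho - 1) / (2 * rho)) ^+ 2 * theta ->
  0 <= s <= c * r%:R -> (r + l).+1%:R <= b ->
  far_bound lambda rho theta r l <= 3 * b ^+ 2 * expR (- s).
Proof.
move=> c1 c2 /andP[s0 sr] rb.
have b1 : 1 <= b by apply: le_trans rb; rewrite ler1n.
have r0 : 0 <= r%:R :> R by [].
have exp_le d : c <= d -> expR (- (d * r%:R)) <= expR (- s).
  move=> cd; rewrite ler_expR lerN2; apply: le_trans sr _; exact: ler_wpM2r.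
rewrite /far_bound; set x := expR (- s).
have x0 : 0 <= x by apply: expR_ge0.
have b2 : b <= b ^+ 2 by rewrite expr2 ler_peMl; lra.
apply: (@le_trans _ _ (2 * b * x + b ^+ 2 * x)).
  apply: lerD; apply: ler_pM; rewrite ?mulr_ge0 ?exprn_ge0 ?expR_ge0 ?exp_le //.
    by rewrite ler_pM2l.
  by rewrite lerXn2r ?nnegrE //; lra.
rewrite -mulrDl; apply: ler_wpM2r => //; lra.
Qed.

(** * Choice of the scales as multiples of log n *)

Section LogScale.
Variables (R : realType) (lambda rho theta eps a e1 c D C1 : R) (n : nat).
Variable C : graph n -> {set 'I_n}.
Local Notation L := (ln n%:R : R).

Hypotheses (lambda1 : 1 < lambda) (theta01 : 0 < theta < 1) (rho1 : 1 < rho).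
Hypothesis drift :
  (rho + theta) * (1 + lambda * theta) * (1 + theta) <= (1 - theta) * lambda.
Hypotheses (lambdaE : lambda = expR a^-1) (rhoE : rho = expR (a + e1)^-1).
Hypotheses (a0 : 0 < a) (e10 : 0 < e1) (e1eps : 24 * e1 <= eps).
Hypotheses (c0 : 0 < c) (c1 : c <= theta ^+ 2 / 2)
  (c2 : c <= lambda * ((rho - 1) / (2 * rho)) ^+ 2 * theta).
Hypotheses (DE : D = 3 / c) (C1E : C1 = 2 * a + 4 * e1 + 2 * D + 8).
Hypotheses (L4 : 4 + lambda <= L) (LD : 2 * (D + 1) <= theta * L)
  (Le : 2 * (e1 + 1) <= theta * L) (Leps : 15 + 12 * C1 / theta ^+ 2 <= eps / 2 * L).
Hypothesis largeC : forall G, is_largest_component (adj G) (C G).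

Let th0 : 0 < theta. Proof. by case/andP: theta01. Qed.

Let L5 : 5 < L. Proof. by have := lambda1; have := L4; lra. Qed.

Let Lpos : 0 < L. Proof. by have := L5; lra. Qed.

Let D0 : 0 < D. Proof. by rewrite DE divr_gt0. Qed.

Let n0 : (0 < n)%N.
Proof. by rewrite lt0n; apply: contraTneq L5 => ->; rewrite ln0 // -leNgt. Qed.

Let nR0 : 0 < n%:R :> R. Proof. by rewrite ltr0n. Qed.

Let nE : n%:R = expR L. Proof. by rewrite lnK. Qed.

(** From n = exp(L) >= L^2 / 2; it makes every multiple of [L] in use small compared with [n]. *)
Let quad x : 0 <= x -> x <= L -> x * L / 2 <= n%:R.
Proof.
move=> x0 xL; have h := expR_ge1Dxn 1 (ltW Lpos).
apply: (@le_trans _ _ (L ^+ 2 / 2)).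
  by rewrite ler_pM2r ?invr_gt0 // expr2 ler_pM2r // (lt_trans _ L5).
by rewrite [leRHS]nE; apply: le_trans h; rewrite lerDr.
Qed.

Let lambdan : lambda <= n%:R.
Proof.
have l1 := lambda1; have l4 := L4; have l5 := L5.
have h : lambda * L / 2 <= n%:R by apply: quad; lra.
by apply: le_trans h; rewrite ler_pdivlMr // ler_pM2l; lra.
Qed.

Let linear_le x (r : nat) : 0 <= x -> 2 * (x + 1) <= theta * L -> r%:R <= x * L + 1 ->
  r%:R <= theta * n%:R.
Proof.
move=> x0 xL /le_trans; apply; have l5 := L5.
have q : L * L / 2 <= n%:R by apply: quad => //; lra.
have h : 2 * (x + 1) * L <= theta * L * L by apply: ler_wpM2r => //; lra.
have g : theta * (L * L / 2) <= theta * n%:R by rewrite ler_pM2l.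
lra.
Qed.

(** Here [a * L] is log n / log lambda, the typical distance. [m] lies just below it and [l] just
    above, with [rho ^+ l > n] because log rho = 1 / (a + e1). [r0] governs typical pairs, [r1] the
    diameter, and [k] is the number of sources. *)
Variables (k l r0 r1 m : nat).
Hypotheses (kL : L < k%:R <= L + 1) (lL : (a + e1) * L < l%:R <= (a + e1) * L + 1)
  (r0L : e1 * L < r0%:R <= e1 * L + 1) (r1L : D * L < r1%:R <= D * L + 1)
  (mL : m%:R <= (a - e1) * L < m.+1%:R).

Let linear_bounds : [/\ (r0 + l).+1%:R <= C1 * L, (r1 + l).+1%:R <= C1 * L,
  m.+1%:R <= C1 * L, (m <= l)%N
  & (r0 + (r0 + l)).+1%:R + (r1 + (r1 + l)).+1%:R <= C1 * L].
Proof.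
have [k1 k2] := andP kL; have [l1 l2] := andP lL; have [r01 r02] := andP r0L.
have [r11 r12] := andP r1L; have [m1 m2] := andP mL; have l5 := L5.
have aL : 0 < a * L by rewrite mulr_gt0.
have eL : 0 < e1 * L by rewrite mulr_gt0.
have DL : 0 < D * L by rewrite mulr_gt0.
have C1L : C1 * L = 2 * (a * L) + 4 * (e1 * L) + 2 * (D * L) + 8 * L.
  by rewrite C1E; ring.
have mE : (a - e1) * L = a * L - e1 * L by ring.
have lE : (a + e1) * L = a * L + e1 * L by ring.
rewrite -!natr1 !natrD C1L; split; try lra.
by rewrite -(ler_nat R); lra.
Qed.

(** The window has width at most 4 e1 L + 5; times 3 this is at most eps L / 2 + 15, by [e1eps].
    With tau = L^-3 and k <= 2L, the exceptional pairs add at most 12 C1 / theta^2, and [Leps]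
    absorbs both constants. *)
Let scale : 3 * (((r0 + (r0 + l)).+1%:R - m%:R) + (L ^+ 3)^-1 *
    ((r0 + (r0 + l)).+1%:R + (r1 + (r1 + l)).+1%:R) * (k%:R / theta) ^+ 2) <= eps * L.
Proof.
have [_ _ _ _ MK] := linear_bounds.
have h1 : (L ^+ 3)^-1 * ((r0 + (r0 + l)).+1%:R + (r1 + (r1 + l)).+1%:R) *
    (k%:R / theta) ^+ 2 <= 4 * C1 / theta ^+ 2.
  have -> : 4 * C1 / theta ^+ 2 = (L ^+ 3)^-1 * (C1 * L) * (2 * L / theta) ^+ 2.
    by field; rewrite !gt_eqF.
  rewrite -[leLHS]mulrA -[leRHS]mulrA ler_pM2l ?invr_gt0 ?exprn_gt0 //; apply: ler_pM => //.
    by rewrite exprn_ge0 // divr_ge0 // ltW.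
  rewrite lerXn2r ?nnegrE ?mulr_ge0 ?invr_ge0 // ?(ltW th0) ?(ltW Lpos) //.
  rewrite ler_pM2r ?invr_gt0 //.
  by have [_ k2] := andP kL; have := L5; lra.
have h2 : 24 * (e1 * L) <= eps * L by rewrite mulrA ler_pM2r.
have h3 : 12 * C1 / theta ^+ 2 = 3 * (4 * C1 / theta ^+ 2) by ring.
have h4 : eps / 2 * L = eps * L / 2 by ring.
have le := Leps; rewrite h3 h4 in le.
have [l1 l2] := andP lL; have [r01 r02] := andP r0L; have [m1 m2] := andP mL.
have mE : (a - e1) * L = a * L - e1 * L by ring.
have lE : (a + e1) * L = a * L + e1 * L by ring.
have mS : m.+1%:R = m%:R + 1 :> R by rewrite natr1.
have ME : (r0 + (r0 + l)).+1%:R = 2 * r0%:R + l%:R + 1 :> R.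
  by rewrite -natr1 !natrD; ring.
move: (_ * _ * (k%:R / theta) ^+ 2) (4 * C1 / theta ^+ 2) h1 le => y z h1 le.
rewrite ME; lra.
Qed.

(** The terms are those of [failure_bound], all put in the form K L^d exp(-xL) to which
    [ln_pow_decay_cvg] applies. *)
Lemma log_scale_bound :
  1 - (1 * (L ^+ 0 * expR (- (theta * L)))
       + 3 * C1 ^+ 2 * (L ^+ 5 * expR (- (c * e1 * L)))
       + 3 * C1 ^+ 2 * (L ^+ 2 * expR (- (1 * L)))
       + C1 * (L ^+ 4 * expR (- (e1 / a * L))))
    <= er_prob (lambda / n%:R) (fun G => avg_hyp (induced_rel (adj G) (C G)) R <= eps * L) <= 1.
Proof.
have l1 := lambda1.
have p01 : 0 <= lambda / n%:R <= 1.
  by apply: edge_prob01 => //; rewrite lambdan andbT; lra.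
have [k1 k2] := andP kL; have [l1' l2] := andP lL; have [r01 r02] := andP r0L.
have [r11 r12] := andP r1L; have [m1 m2] := andP mL; have l5 := L5.
have [b0 b1 bm ml _] := linear_bounds.
have L0 : L != 0 by rewrite gt_eqF.
have tau0 : 0 < (L ^+ 3)^-1 by rewrite invr_gt0 exprn_gt0.
have kn : (0 < k <= n)%N.
  have k0 : (0 < k)%N by rewrite -(ltr_nat R); lra.
  have h : 4 * L / 2 <= n%:R by apply: quad; lra.
  by rewrite k0 -(ler_nat R); lra.
have r0n : r0%:R <= theta * n%:R by apply: (linear_le (ltW e10) Le).
have r1n : r1%:R <= theta * n%:R by apply: (linear_le (ltW D0) LD).
have nl : n%:R < rho ^+ l.
  rewrite rhoE -expRM_natl nE ltr_expR ltr_pdivlMr ?addr_gt0 //.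
  by rewrite mulrC.
have leM : (m <= (r0 + (r0 + l)).+1)%N.
  by rewrite addnA (leq_trans ml) // leqW // leq_addl.
apply/andP; split; last first.
  rewrite er_probE -[leRHS](Ex_const (vpair n : finType) (lambda / n%:R)).
  by apply: Ex_le => // G; rewrite lern1 leq_b1.
rewrite lerBlDr -lerBlDl.
have := failure_bound n0 lambdan (ltW lambda1) theta01 rho1 drift largeC kn tau0 r0n r1n nl leM scale.
move/le_trans; apply; apply: lerD; first apply: lerD; first apply: lerD.
- by rewrite expr0 !mul1r ler_expR mulNr lerN2 ler_pM2l // ltW.
- rewrite invrK.
  have h := @far_bound_le _ lambda rho theta c (C1 * L) (c * e1 * L) r0 l c1 c2 _ b0.
  apply: le_trans (ler_wpM2r _ (h _)) _.
  + by rewrite exprn_ge0 // ltW.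
  + by rewrite -mulrA mulr_ge0 ?ler_pM2l ?(ltW r01) ?mulr_ge0 // ltW.
  by rewrite le_eqVlt; apply/orP; left; apply/eqP; ring.
- have h := @far_bound_le _ lambda rho theta c (C1 * L) (3 * L) r1 l c1 c2 _ b1.
  apply: le_trans (ler_wpM2l (exprn_ge0 2 (ltW nR0)) (h _)) _.
    (* The choice [D = 3 / c] gives decay n^-3, which beats the n^2 pairs and leaves 1 / n. *)
    have -> : 3 * L = c * (D * L) by rewrite DE; field; rewrite gt_eqF.
    by rewrite mulr_ge0 ?ler_pM2l ?(ltW r11) ?mulr_ge0 // ltW.
  have -> : expR (- (1 * L)) = n%:R ^+ 2 * expR (- (3 * L)).
    by rewrite [X in X ^+ 2]nE -expRM_natl -expRD; congr expR; ring.
  by rewrite le_eqVlt; apply/orP; left; apply/eqP; ring.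
(* Stopping [e1 * L] short of the typical distance saves the power n^(-e1 / a). *)
have pm : lambda ^+ m <= n%:R * expR (- (e1 / a * L)).
  rewrite [in leLHS]lambdaE -expRM_natl.
  have -> : n%:R * expR (- (e1 / a * L)) = expR (L - e1 / a * L) by rewrite expRD -nE.
  rewrite ler_expR ler_pdivrMr //; have -> : (L - e1 / a * L) * a = (a - e1) * L by field; rewrite gt_eqF.
  exact: m1.
have -> : m.+1%:R * lambda ^+ m / (n%:R * (L ^+ 3)^-1) = m.+1%:R * (lambda ^+ m / n%:R) * L ^+ 3.
  by rewrite invfM invrK !mulrA.
have -> : C1 * (L ^+ 4 * expR (- (e1 / a * L))) = C1 * L * expR (- (e1 / a * L)) * L ^+ 3.
  by rewrite exprS; ring.
apply: ler_wpM2r; first by rewrite exprn_ge0 // ltW.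
apply: ler_pM => //.
  by rewrite divr_ge0 ?exprn_ge0 //; lra.
by rewrite ler_pdivrMr // mulrC.
Qed.

End LogScale.


(* Cmax is the largest component, ties being broken in an arbitrary way. *)
Theorem theorem5p16 (R : realType) (lambda : R) (hlambda : 1 < lambda)
  (Cmax : forall n : nat, graph n -> {set 'I_n})
  (hCmax : forall (n : nat) (G : graph n), (0 < n)%N ->
     is_largest_component (adj G) (Cmax n G))
  (eps : R) (heps : 0 < eps) :
  (fun n : nat => er_prob (lambda / n%:R)
     (fun G : graph n =>
        avg_hyp (induced_rel (adj G) (Cmax n G)) R <= eps * ln (n%:R : R)))
    @ \oo --> (1 : R).
Proof.
pose a : R := (ln lambda)^-1; have a0 : 0 < a by rewrite invr_gt0 ln_gt0.
(* The bound [a / 2] keeps [a - e1] nonnegative, as the truncation defining [m] requires; [eps / 24]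
   fits the window into half of eps L. *)
pose e1 : R := Num.min (a / 2) (eps / 24).
have e10 : 0 < e1 by rewrite lt_min !divr_gt0.
have e1a : e1 <= a / 2 by rewrite ge_min lexx.
have e1eps : 24 * e1 <= eps by rewrite -ler_pdivlMl // mulrC ge_min lexx orbT.
pose rho : R := expR (a + e1)^-1.
have rho1 : 1 < rho by rewrite expR_gt1 invr_gt0 addr_gt0.
have lambdaE : lambda = expR a^-1 by rewrite invrK lnK // posrE (lt_trans ltr01).
have rho_lt : rho < lambda by rewrite lambdaE ltr_expR ltf_pV2 ?posrE ?addr_gt0 // ltrDl.
have [theta theta01 drift] := drift_parameter rho1 rho_lt.
have [th0 th1] := andP theta01.
pose c : R := Num.min (theta ^+ 2 / 2) (lambda * ((rho - 1) / (2 * rho)) ^+ 2 * theta).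
have c0 : 0 < c.
  have rho0 : 0 < rho := expR_gt0 _; have lambda0 : 0 < lambda := lt_trans ltr01 hlambda.
  have mu0 : 0 < (rho - 1) / (2 * rho) by rewrite divr_gt0 ?mulr_gt0 ?subr_gt0.
  rewrite lt_min; apply/andP; split; first by apply: divr_gt0 => //; apply: exprn_gt0.
  by apply: mulr_gt0 => //; apply: mulr_gt0 => //; apply: exprn_gt0.
have c1 : c <= theta ^+ 2 / 2 by rewrite ge_min lexx.
have c2 : c <= lambda * ((rho - 1) / (2 * rho)) ^+ 2 * theta by rewrite ge_min lexx orbT.
pose D : R := 3 / c; have D0 : 0 < D by rewrite divr_gt0.
pose C1 : R := 2 * a + 4 * e1 + 2 * D + 8.
pose f (n : nat) : R := 1 * (ln n%:R ^+ 0 * expR (- (theta * ln n%:R)))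
       + 3 * C1 ^+ 2 * (ln n%:R ^+ 5 * expR (- (c * e1 * ln n%:R)))
       + 3 * C1 ^+ 2 * (ln n%:R ^+ 2 * expR (- (1 * ln n%:R)))
       + C1 * (ln n%:R ^+ 4 * expR (- (e1 / a * ln n%:R))).
have f0 : f @ \oo --> (0 : R).
  have K0 (K x : R) d : 0 < x ->
      (fun n : nat => K * (ln n%:R ^+ d * expR (- (x * ln n%:R)))) @ \oo --> (0 : R).
    by move=> x0; rewrite -[0](mulr0 K); apply: cvgMr; apply: ln_pow_decay_cvg.
  have := cvgD (cvgD (cvgD (K0 1 theta 0%N th0) (K0 (3 * C1 ^+ 2) (c * e1) 5 (mulr_gt0 c0 e10)))
    (K0 (3 * C1 ^+ 2) 1 2 ltr01)) (K0 C1 (e1 / a) 4 (divr_gt0 e10 a0)).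
  by rewrite !addr0; apply.
apply: (squeeze_cvgr (f := fun n => 1 - f n) (h := fun=> 1)); last 2 first.
- by rewrite -[1 in X in _ --> X](subr0 1); apply: cvgB => //; apply: cvg_cst.
- exact: cvg_cst.
near=> n.
have L1 : 4 + lambda <= ln (n%:R : R) by near: n; exact: near_ln_ge.
have L2 : 2 * (D + 1) / theta <= ln (n%:R : R) by near: n; exact: near_ln_ge.
have L3 : 2 * (e1 + 1) / theta <= ln (n%:R : R) by near: n; exact: near_ln_ge.
have L4 : (15 + 12 * C1 / theta ^+ 2) / (eps / 2) <= ln (n%:R : R).
  by near: n; exact: near_ln_ge.
have L0 : 0 < ln (n%:R : R) by move: hlambda L1; lra.
(* As [ln 0] is 0 by convention, a positive logarithm excludes n = 0. *)
have n0 : (0 < n)%N.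
  by rewrite lt0n; apply: contraTneq L0 => ->; rewrite ln0 // ltxx.
rewrite ler_pdivrMr // [leRHS]mulrC in L2; rewrite ler_pdivrMr // [leRHS]mulrC in L3.
rewrite ler_pdivrMr ?divr_gt0 // [leRHS]mulrC in L4.
have largeC G : is_largest_component (adj G) (Cmax n G) by apply: hCmax.
apply: (log_scale_bound hlambda theta01 rho1 drift lambdaE erefl a0 e10 e1eps c0 c1 c2
  erefl erefl L1 L2 L3 L4 largeC
  (k := (Num.truncn (ln n%:R)).+1) (l := (Num.truncn ((a + e1) * ln n%:R)).+1)
  (r0 := (Num.truncn (e1 * ln n%:R)).+1) (r1 := (Num.truncn (D * ln n%:R)).+1)
  (m := Num.truncn ((a - e1) * ln n%:R))).
- exact/truncnS_itv/ltW.
- by apply/truncnS_itv; rewrite mulr_ge0 ?(ltW L0) // ltW // addr_gt0.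
- by apply/truncnS_itv; rewrite mulr_ge0 ?ltW.
- by apply/truncnS_itv; rewrite mulr_ge0 ?ltW.
apply: truncn_itv; rewrite mulr_ge0 ?(ltW L0) //.
by move: e1a a0; lra.
Unshelve. all: by end_near. Qed.
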